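(* Let $X\subset\mathbb{R}^{2n}$ be a bounded (Lebesgue measurable) subset. If $c^B(X)$ is strictly greater than $\overline{\mathrm{Vol}}(X)$, then $$\frac{(\mathrm{M}_{\mathrm{Symp}}(X))^2}{4}>\overline{\mathrm{Vol}}(X).$$
   Context: $B^{2n}\subset\mathbb{R}^{2n}$ is the closed unit ball. The normalized volume is $\overline{\mathrm{Vol}}(X)=\left(\mathrm{Vol}(X)/\mathrm{Vol}(B^{2n})\right)^{1/n}$. For a bounded subset $X\subset\mathbb{R}^{2n}$, the support function is $h_X(u)=\sup_{k\in X}\langle k,u\rangle$, the mean width is $\mathrm{M}(X)=\int_{S^{2n-1}}(h_X(u)+h_X(-u))\,d\sigma$ with $\sigma$ the rotationally invariant probability measure on the unit sphere, and $\mathrm{M}_{\mathrm{Symp}}(X)=\inf_{\phi\in\mathrm{Symp}}\mathrm{M}(\phi(X))$, where $\mathrm{Symp}$ is the group of symplectomorphisms of $\mathbb{R}^{2n}$ with its standard symplectic structure. The embedding capacity is $c^B(X)=\inf\{R^2: \text{there is a symplectic embedding } \phi\colon X\hookrightarrow R\,B^{2n}\}$; in particular restrictions to $X$ of elements of $\mathrm{Symp}$ are symplectic embeddings of $X$. *)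

(* Defs.v *)
From HB Require Import structures.
From mathcomp Require Import all_boot all_order all_algebra.
From mathcomp Require Import all_classical all_reals all_analysis.

Set Implicit Arguments.
Unset Strict Implicit.
Unset Printing Implicit Defensive.

Import Order.TTheory GRing.Theory Num.Theory.
Import numFieldNormedType.Exports.

Local Open Scope classical_set_scope.
Local Open Scope ring_scope.

(* The library norm `|x| on 'rV[R]_d is the max norm; it is used only through
   its topology and bornology.  The Euclidean structure is defined here. *)
Definition dotv (R : realType) (d : nat) (u v : 'rV[R]_d) : R :=
  \sum_(i < d) u ord0 i * v ord0 i.

Definition enorm (R : realType) (d : nat) (u : 'rV[R]_d) : R :=
  Num.sqrt (dotv u u).

Definition eball (R : realType) (d : nat) (r : R) : set 'rV[R]_d :=
  [set x | enorm x <= r].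
Arguments eball {R} d r.

Definition esphere (R : realType) (d : nat) : set 'rV[R]_d :=
  [set x | enorm x = 1].
Arguments esphere R d : clear implicits.

Section LebesgueMeasure.
Variables (R : realType) (d : nat).
Implicit Types (a b : 'rV[R]_d) (X : set 'rV[R]_d).

Definition box a b : set 'rV[R]_d :=
  [set x | forall i, a ord0 i <= x ord0 i <= b ord0 i].

Definition box_volume a b : R := \prod_(i < d) (b ord0 i - a ord0 i).

(* The condition a k <= b k below matters: box_volume can be negative on
   unordered endpoints. *)
Definition lebesgue_outer X : \bar R :=
  ereal_inf [set s | exists a b : nat -> 'rV[R]_d,
    [/\ forall k i, a k ord0 i <= b k ord0 i,
        X `<=` \bigcup_k box (a k) (b k) &
        s = (\sum_(0 <= k <oo) (box_volume (a k) (b k))%:E)%E]].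

Definition lebesgue_measurable X : Prop := lebesgue_outer.-caratheodory X.

End LebesgueMeasure.

Definition normalized_volume (R : realType) (n : nat)
    (X : set 'rV[R]_(n + n)) : R :=
  (fine (lebesgue_outer X) / fine (lebesgue_outer (eball (n + n)%N (1 : R))))
    `^ (n%:R^-1).

(* C^k on an open set U, through directional derivatives of order <= k. *)
Fixpoint Ck_on (R : realType) (V W : normedModType R) (k : nat)
    (U : set V) (f : V -> W) : Prop :=
  match k with
  | 0 => forall x, U x -> {for x, continuous f}
  | k'.+1 => (forall x, U x -> differentiable f x) /\
             (forall v : V, Ck_on k' U ('D_v f))
  end.

Definition smooth_on (R : realType) (V W : normedModType R)
    (U : set V) (f : V -> W) : Prop := forall k, Ck_on k U f.

Section Symplectic.
Variables (R : realType) (n : nat).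
Local Notation E := 'rV[R]_(n + n).
Implicit Types (U X : set E) (f phi : E -> E).

(* Coordinates are (q_1, .., q_n, p_1, .., p_n) and omega = sum dq_i /\ dp_i. *)
Definition symp_mx : 'M[R]_(n + n) := block_mx 0 1%:M (- 1%:M) 0.

Definition omega (u v : E) : R := (u *m symp_mx *m v^T) ord0 ord0.

Definition preserves_omega U f : Prop :=
  forall x, U x -> forall u v, omega ('d f x u) ('d f x v) = omega u v.

(* f restricts to a diffeomorphism from the open set U onto the open set
   f @` U and preserves omega: as source and target have the same dimension,
   this is a symplectic embedding of U. *)
Definition open_symplectic_embedding U f : Prop :=
  [/\ open U, open (f @` U), smooth_on U f, preserves_omega U f &
      exists g : E -> E,
        smooth_on (f @` U) g /\ forall x, U x -> g (f x) = x].

Definition Symp : set (E -> E) :=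
  [set phi | open_symplectic_embedding setT phi /\ phi @` setT = setT].

(* For an arbitrary subset X, a symplectic embedding is one of an open
   neighbourhood of X. *)
Definition symplectic_embedding X f : Prop :=
  exists2 U, X `<=` U & open_symplectic_embedding U f.

Definition embedding_capacity X : R :=
  inf [set r ^+ 2 | r in [set r : R | 0 <= r /\
         exists f, symplectic_embedding X f /\ f @` X `<=` eball (n + n)%N r]].

End Symplectic.

Definition borel_space (R : realType) (d : nat) :=
  g_sigma_algebraType (@open 'rV[R]_d).

(* The rotationally invariant probability measure on the unit sphere, viewed
   as a Borel measure on the ambient space carried by the sphere. *)
Definition rotation_invariant_sphere_probability (R : realType) (d : nat)
    (sigma : probability (borel_space R d) R) : Prop :=
  sigma (esphere R d) = 1%E /\
  forall Q : 'M[R]_d, Q *m Q^T = 1%:M -> \det Q = 1 ->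
  forall A : set (borel_space R d), measurable A ->
    sigma [set x : 'rV[R]_d | A (x *m Q)] = sigma A.

Definition support_function (R : realType) (d : nat)
    (X : set 'rV[R]_d) (u : 'rV[R]_d) : R :=
  sup [set dotv k u | k in X].

Definition mean_width (R : realType) (d : nat)
    (sigma : probability (borel_space R d) R) (X : set 'rV[R]_d) : R :=
  \int[sigma]_(u in esphere R d)
    (support_function X u + support_function X (- (u : 'rV[R]_d))).

Definition symplectic_mean_width (R : realType) (n : nat)
    (sigma : probability (borel_space R (n + n)%N) R)
    (X : set 'rV[R]_(n + n)) : R :=
  inf [set mean_width sigma (phi @` X) | phi in @Symp R n].

(* Main.v *)
(* Fix V = vol(X) and let m0 be the infimum of the half mean width
   m(Y) = (integral of h_Y over the sphere) over all bounded Y with vol(Y) >= V;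
   these include all phi(X), as symplectomorphisms preserve volume. Let K be the convex body with
   support function h_Y and S its Steiner symmetral in a direction e, with R the
   reflection in the hyperplane orthogonal to e. Then vol(S) >= vol(K) >= V and
   h_S <= (h_Y + h_Y o R) / 2, so m0 <= m(S) <= m(Y). If m(Y) is close to m0, this
   inequality is almost an equality in every direction, which forces h_Y - h_Y o R
   to be nearly linear. For all e together, h_Y is nearly constant up to a linear
   function: a near-minimizer Y lies, up to a translation, in a ball of radius
   m0 + epsilon.

   Comparing volumes, the normalized volume v of X is at most m0^2 (Urysohn's
   inequality, with its stability), and m0 <= M_Symp(X) / 2. If M_Symp(X)^2 / 4 <= v,
   then all these are equalities, some phi(X) are near-minimizers, hence lie in
   translated balls of radius m0 + epsilon, and c^B(X) <= m0^2 = v. *)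
Require Import Defs.
From mathcomp Require Import all_boot all_order all_algebra.
From mathcomp Require Import all_classical all_reals all_analysis.
From mathcomp Require Import perm measurable_realfun ring lra.
Import Order.TTheory GRing.Theory Num.Theory.
Import numFieldNormedType.Exports.
Local Open Scope classical_set_scope.
Local Open Scope ring_scope.

Set Implicit Arguments.
Unset Strict Implicit.
Unset Printing Implicit Defensive.

(** * The Lebesgue outer measure *)

(** The infimum ranges over all bounded sets of enough volume because symmetrization leaves the
    orbit of [X], and volume is all that survives it. Instead of a limiting minimizer there are
    estimates whose [eta] depends on [e] and on a radius [r], but not on the set; the radius is
    bounded a priori by the mean width, once the set is translated to contain 0. Volume enters
    through three inequalities: for linear images, for maps with Jacobian of modulus 1, and for
    Steiner symmetrals. All follow one scheme: when a box is halved, the right side is additive and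
    the left side subadditive, so a failure passes to one of the halves, and after enough halvings
    it contradicts an estimate for thin or small boxes. Reflections have determinant -1, whereas
    [sigma] is given as invariant under determinant 1. The gap is closed by averaging over caps,
    whose mass is the same at every point of the sphere. *)

Section OuterMeasure.
Variables (R : realType) (d : nat).
Implicit Types (a b x y : 'rV[R]_d) (X Y : set 'rV[R]_d).
Local Notation mu := (@lebesgue_outer R d).

Lemma box_volume_ge0 a b : (forall i, a ord0 i <= b ord0 i) ->
  0 <= box_volume a b.
Proof. by move=> ab; apply: prodr_ge0 => i _; rewrite subr_ge0. Qed.

Lemma lebesgue_outer_ge0 X : (0 <= mu X)%E.
Proof.
apply: le_ereal_inf_tmp => _ [a [b [ab _ ->]]].
by apply: nneseries_ge0 => k _ _; rewrite lee_fin box_volume_ge0.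
Qed.

Lemma le_lebesgue_outer X Y : X `<=` Y -> (mu X <= mu Y)%E.
Proof.
move=> XY; apply: ereal_inf_le_tmp => s [a [b [ab Yab ->]]].
by exists a, b; split => //; exact: subset_trans XY Yab.
Qed.

Lemma lebesgue_outer_le_cover X (a b : nat -> 'rV[R]_d) :
  (forall k i, a k ord0 i <= b k ord0 i) -> X `<=` \bigcup_k box (a k) (b k) ->
  (mu X <= \sum_(0 <= k <oo) (box_volume (a k) (b k))%:E)%E.
Proof. by move=> ab Xab; apply: ereal_inf_lbound; exists a, b. Qed.

Lemma exists_cover X (x : \bar R) : (mu X < x)%E ->
  exists a b : nat -> 'rV[R]_d, [/\ forall k i, a k ord0 i <= b k ord0 i,
    X `<=` \bigcup_k box (a k) (b k) &
    (\sum_(0 <= k <oo) (box_volume (a k) (b k))%:E < x)%E].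
Proof.
by move=> /ereal_inf_lt[_ [a [b [ab Xab ->]]] abx]; exists a, b.
Qed.

Lemma lebesgue_outer_bigcup_le (A : nat -> set 'rV[R]_d) :
  (mu (\bigcup_n A n) <= \sum_(0 <= n <oo) mu (A n))%E.
Proof.
have [[i ioo]|] := pselect (exists i, mu (A i) = +oo%E).
  rewrite (eseries_pinfty _ _ ioo) ?leey// => n _.
  by rewrite -ltNye (lt_le_trans _ (lebesgue_outer_ge0 _)).
rewrite -forallNE => Aoo.
apply/lee_addgt0Pr => e e0.
apply: (le_trans _ (epsilon_trick _ (fun n => lebesgue_outer_ge0 (A n)) (ltW e0))).
pose P n (G : nat -> 'rV[R]_d * 'rV[R]_d) :=
  [/\ forall k i, (G k).1 ord0 i <= (G k).2 ord0 i,
    A n `<=` \bigcup_k box (G k).1 (G k).2 &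
   (\sum_(0 <= k <oo) (box_volume (G k).1 (G k).2)%:E <= mu (A n) + (e / (2 ^ n.+1)%:R)%:E)%E].
have [G PG] : {G : nat -> nat -> 'rV[R]_d * 'rV[R]_d & forall n, P n (G n)}.
  apply: (@choice _ _ P) => n.
  have /exists_cover[a [b [ab Aab abx]]] :
      (mu (A n) < mu (A n) + (e / (2 ^ n.+1)%:R)%:E)%E.
    rewrite lteDl ?lte_fin ?divr_gt0// ?ltr0n ?expn_gt0//.
    by rewrite ge0_fin_numE ?lebesgue_outer_ge0// ltey; exact/eqP/Aoo.
  by exists (fun k => (a k, b k)); split => //=; exact: ltW.
pose v (p : nat * nat) : \bar R := (box_volume (G p.1 p.2).1 (G p.1 p.2).2)%:E.
have v0 p : (0 <= v p)%E.
  by rewrite lee_fin box_volume_ge0// => i; have [] := PG p.1.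
have /card_esym/ppcard_eqP[f] := card_nat2.
apply: (@le_trans _ _ (\esum_(p in setT) v p)).
  apply: (@le_trans _ _ (\sum_(0 <= k <oo) v (f k))%E).
    apply: (@lebesgue_outer_le_cover _ (fun k => (G (f k).1 (f k).2).1)
                               (fun k => (G (f k).1 (f k).2).2)).
      by move=> k i; have [+ _ _] := PG (f k).1; exact.
    move=> x [n _ Anx]; have [_ /(_ _ Anx)[k _ Gx] _] := PG n.
    exists (f^-1%FUN (n, k)) => //=.
    by rewrite invK ?inE.
  rewrite nneseries_esumT; last by move=> k; exact: v0.
  by rewrite -(reindex_esum setT setT f v)//; exact: bij.
have -> : \esum_(p in setT) v p = (\sum_(0 <= i <oo) \sum_(0 <= j <oo) v (i, j))%E.
  rewrite nneseries_esumT; last by move=> i; apply: nneseries_ge0.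
  have -> : [set: nat * nat] = [set: nat] `*` [set: nat].
    by apply/seteqP; split.
  have -> : [set: nat] `*` [set: nat] = setT `*`` (fun=> [set: nat]).
    by apply/seteqP; split.
  rewrite -(@esum_esum _ _ _ setT (fun=> setT) (fun i j => v (i, j))) //.
  rewrite /=. apply: eq_esum => i _; rewrite nneseries_esumT//.
apply: lee_nneseries => [i _ _|n _]; first by apply: nneseries_ge0.
by have [] := PG n.
Qed.

Lemma lebesgue_outer_box a b : (0 < d)%N ->(forall i, a ord0 i <= b ord0 i) ->
  (mu (box a b) <= (box_volume a b)%:E)%E.
Proof.
(* The box is followed by copies of the degenerate box from [a] to [a], of volume 0 because [d] is
   positive; in dimension 0 the empty product would be 1. *)
move=> d0 ab; apply: (@le_trans _ _ (\sum_(0 <= k <oo)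
  (box_volume a (if k is 0 then b else a))%:E)%E).
  apply: (@lebesgue_outer_le_cover _ (fun=> a)); first by case.
  by move=> x xab; exists 0%N.
rewrite (@nneseries_split _ _ 0 1)//; last first.
  by case=> [|k] _; rewrite lee_fin box_volume_ge0.
rewrite add0n big_nat1 eseries0 ?adde0// => -[|i]// _ _.
by rewrite /box_volume (bigD1 (Ordinal d0))//= subrr mul0r.
Qed.

End OuterMeasure.

Section OpenCovers.
Variables (R : realType) (d : nat).
Implicit Types (a b x y : 'rV[R]_d) (X Y : set 'rV[R]_d).
Local Notation mu := (@lebesgue_outer R d).

Lemma box_volume_enlarge a b (e : R) : 0 < e ->
  exists2 r : R, 0 < r & box_volume (a - const_mx r) (b + const_mx r) < box_volume a b + e.
Proof.
move=> e0.
have : (\prod_(i < d) (b ord0 i + r - (a ord0 i - r))) @[r --> (0 : R)] -->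
    box_volume a b.
  have -> : box_volume a b = \prod_(i < d) (b ord0 i + 0 - (a ord0 i - 0)).
    by apply: eq_bigr => i _; rewrite addr0 subr0.
  apply: cvg_big; first exact: mul_continuous.
  move=> i _; apply: cvgB; first by apply: cvgD; [exact: cvg_cst|exact: cvg_id].
  by apply: cvgB; [exact: cvg_cst|exact: cvg_id].
move=> /cvgrPdist_lt /(_ _ e0) /nbhs_ballP[r /= r0] H.
exists (r / 2); first by rewrite divr_gt0.
have /H : ball (0 : R) r (r / 2).
  by rewrite /ball/= sub0r normrN gtr0_norm ?divr_gt0//; lra.
rewrite ltr_norml => /andP[h _].
have -> : box_volume (a - const_mx (r / 2)) (b + const_mx (r / 2)) =
    \prod_(i < d) (b ord0 i + r / 2 - (a ord0 i - r / 2)).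
  by apply: eq_bigr => i _; rewrite !mxE.
lra.
Qed.

(** Enlarging the [k]-th box costs at most [e / (2 ^ k.+1)%:R], which fits in the slack below [x].
    The strict sides permit bisection, and the strict inclusions leave room around each covered
    point. *)
Lemma exists_open_cover X (x : \bar R) : (mu X < x)%E ->
  exists a b : nat -> 'rV[R]_d, [/\ forall k i, a k ord0 i < b k ord0 i,
    forall y, X y -> exists k, forall i, a k ord0 i < y ord0 i < b k ord0 i &
    (\sum_(0 <= k <oo) (box_volume (a k) (b k))%:E < x)%E].
Proof.
move=> /exists_cover[a [b [ab Xab]]].
have s0 : (0 <= \sum_(0 <= k <oo) (box_volume (a k) (b k))%:E)%E.
  by apply: nneseries_ge0 => k _ _; rewrite lee_fin box_volume_ge0.
set s := (\sum_(0 <= k <oo) _)%E in s0 *.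
move=> sx.
have [e e0 sex] : exists2 e : R, 0 < e & (s + e%:E < x)%E.
  have sf : s \is a fin_num by rewrite ge0_fin_numE// (lt_le_trans sx)// leey.
  move: x sx => [x| |]; rewrite -(fineK sf).
  - rewrite lte_fin => sx; exists ((x - fine s) / 2); first by rewrite divr_gt0// subr_gt0.
    by rewrite -EFinD lte_fin; lra.
  - by exists 1 => //; rewrite -EFinD ltey.
  - by [].
have /choice[r Hr] : forall k, exists r : R, 0 < r /\
    box_volume (a k - const_mx r) (b k + const_mx r) < box_volume (a k) (b k) + e / (2 ^ k.+1)%:R.
  move=> k; have [|r r0 H] := @box_volume_enlarge (a k) (b k) (e / (2 ^ k.+1)%:R).
    by rewrite divr_gt0// ltr0n expn_gt0.
  by exists r.
exists (fun k => a k - const_mx (r k)), (fun k => b k + const_mx (r k)); split.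
- move=> k i; rewrite !mxE; have [r0 _] := Hr k; have := ab k i; lra.
- move=> y /Xab[k _ /= kab]; exists k => i; rewrite !mxE.
  by have [r0 _] := Hr k; have := kab i; lra.
- apply: le_lt_trans sex.
  apply: (le_trans _ (epsilon_trick _ _ (ltW e0))); last first.
    by move=> k; rewrite lee_fin box_volume_ge0.
  apply: lee_nneseries => k _.
    rewrite lee_fin box_volume_ge0// => i; rewrite !mxE.
    by have [r0 _] := Hr k; have := ab k i; lra.
  by rewrite -EFinD lee_fin ltW//; have [] := Hr k.
Qed.

Lemma lebesgue_outer_translate X a : (mu ((fun x => x + a)%R @` X) <= mu X)%E.
Proof.
apply: le_ereal_inf_tmp => _ [u [v [uv Xuv ->]]].
have -> : (\sum_(0 <= k <oo) (box_volume (u k) (v k))%:E =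
    \sum_(0 <= k <oo) (box_volume (u k + a) (v k + a))%:E)%E.
  apply: eq_eseriesr => k _; congr EFin; apply: eq_bigr => i _.
  by rewrite !mxE; ring.
apply: lebesgue_outer_le_cover => [k i|_ [x /Xuv[k _ kx] <-]].
  by rewrite !mxE lerD2r.
by exists k => // i; rewrite !mxE !lerD2r.
Qed.

End OpenCovers.

(** * Bisection of boxes *)

Section Bisection.
Variables (R : realType) (d : nat).
Implicit Types (a b x y : 'rV[R]_d).

Definition upd a (j : 'I_d) (c : R) : 'rV[R]_d :=
  \row_i (if i == j then c else a ord0 i).

Definition midpt a b (j : 'I_d) : R := (a ord0 j + b ord0 j) / 2.

Variables (J : pred 'I_d) (bad : 'rV[R]_d -> 'rV[R]_d -> Prop).
Hypothesis bad_split : forall a b j, J j -> (forall i, a ord0 i < b ord0 i) ->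
  bad a b -> bad a (upd b j (midpt a b j)) \/ bad (upd a j (midpt a b j)) b.

(** Induction on the total number of halvings still owed. Which half survives is not under control,
    but the side lengths are; unequal counts [k i] give boxes of any prescribed elongation. *)
Lemma bisect_shape (k : 'I_d -> nat) a b :
  (forall i, ~~ J i -> k i = 0%N) -> (forall i, a ord0 i < b ord0 i) ->
  bad a b -> exists a' b', bad a' b' /\
  forall i, [/\ a ord0 i <= a' ord0 i, b' ord0 i <= b ord0 i &
    b' ord0 i - a' ord0 i = (b ord0 i - a ord0 i) / 2 ^+ (k i)].
Proof.
have [n] := ubnP (\sum_i k i)%N; elim: n k a b => // n IH k a b kn kJ ab bab.
have [k0|] := pselect (forall i, k i = 0%N).
  by exists a, b; split=> // i; split=> //; rewrite k0 expr0 divr1.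
move=> /existsNP[j /eqP kj].
have Jj : J j by apply: contraT => /kJ /eqP; rewrite (negbTE kj).
pose k' i := (k i - (i == j))%N.
have kk' : (\sum_i k' i < n)%N.
  rewrite -ltnS; apply: leq_trans kn; rewrite ltnS.
  rewrite (bigD1 j)//= [ltnRHS](bigD1 j)//= /k' eqxx.
  rewrite (eq_bigr k); last by move=> i /negbTE ->; rewrite subn0.
  by rewrite ltn_add2r subn1 ltn_predL lt0n.
have k'J i : ~~ J i -> k' i = 0%N by rewrite /k' => /kJ ->.
have kE i : k i = (k' i + (i == j))%N.
  by rewrite /k' subnK//; case: eqP => [->|//]; rewrite lt0n.
have H a1 b1 : bad a1 b1 -> (forall i, [/\ a ord0 i <= a1 ord0 i, b1 ord0 i <= b ord0 i &
    b1 ord0 i - a1 ord0 i = (b ord0 i - a ord0 i) / 2 ^+ (i == j)]) ->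
  exists a' b', bad a' b' /\
  forall i, [/\ a ord0 i <= a' ord0 i, b' ord0 i <= b ord0 i &
    b' ord0 i - a' ord0 i = (b ord0 i - a ord0 i) / 2 ^+ (k i)].
  move=> bad1 H1; have [|a' [b' [bad' H']]] := IH _ a1 b1 kk' k'J _ bad1.
    by move=> i; rewrite -subr_gt0; have [_ _ ->] := H1 i; rewrite divr_gt0 ?exprn_gt0// subr_gt0.
  exists a', b'; split => // i; have [h1 h2 h3] := H1 i; have [g1 g2 g3] := H' i.
  split; [lra|lra|].
  by rewrite g3 h3 kE exprD invfM mulrA mulrAC.
have m1 i : midpt a b i - a ord0 i = (b ord0 i - a ord0 i) / 2 by rewrite /midpt; lra.
have m2 i : b ord0 i - midpt a b i = (b ord0 i - a ord0 i) / 2 by rewrite /midpt; lra.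
have [bad1|bad1] := bad_split Jj ab bab; apply: (H _ _ bad1) => i; rewrite !mxE;
  have abi := ab i; case: eqP => [->|_]; rewrite ?expr1 ?expr0 ?divr1; split => //;
  have := m1 j; have := m2 j; have := ab j; lra.
Qed.

(** Each round halves every coordinate of [J] once, and the nested intervals close on [x].
    Coordinates outside [J] keep their full range: for Steiner symmetrization the boxes shrink to a
    vertical segment instead of a point. *)
Lemma bisect_nested a b : (forall i, a ord0 i < b ord0 i) -> bad a b ->
  exists x, forall n, exists a' b', bad a' b' /\
  forall i, [/\ a ord0 i <= a' ord0 i, b' ord0 i <= b ord0 i,
    b' ord0 i - a' ord0 i = (b ord0 i - a ord0 i) / 2 ^+ (if J i then n else 0) &
    a' ord0 i <= x ord0 i <= b' ord0 i].
Proof.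
move=> ab bab.
pose good (p : 'rV[R]_d * 'rV[R]_d) := bad p.1 p.2 /\ forall i, p.1 ord0 i < p.2 ord0 i.
have /choice[F HF] : forall p, exists q, good p -> good q /\
    forall i, [/\ p.1 ord0 i <= q.1 ord0 i, q.2 ord0 i <= p.2 ord0 i &
    q.2 ord0 i - q.1 ord0 i = (p.2 ord0 i - p.1 ord0 i) / 2 ^+ J i].
  move=> [u v]; have [[/= buv uv]|] := pselect (good (u, v)); last by exists (u, v).
  have [|u' [v' [bad' H]]] := @bisect_shape (fun i => nat_of_bool (J i)) u v _ uv buv.
    by move=> i /negbTE ->.
  exists (u', v') => _; split => //; split => // i /=.
  by rewrite -subr_gt0; have [_ _ ->] := H i; rewrite divr_gt0 ?exprn_gt0// subr_gt0.
pose s n := iter n F (a, b).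
have gs n : good (s n) by elim: n => [//|n IH] /=; have [] := HF _ IH.
have sS n i : [/\ (s n).1 ord0 i <= (s n.+1).1 ord0 i, (s n.+1).2 ord0 i <= (s n).2 ord0 i &
    (s n.+1).2 ord0 i - (s n.+1).1 ord0 i = ((s n).2 ord0 i - (s n).1 ord0 i) / 2 ^+ J i].
  by have [_] := HF _ (gs n).
have s1 m n i : (m <= n)%N -> (s m).1 ord0 i <= (s n).1 ord0 i.
  move=> /subnK <-; elim: (n - m)%N => [//|k IH].
  by apply: le_trans IH _; have [] := sS (k + m)%N i.
have s2 m n i : (m <= n)%N -> (s n).2 ord0 i <= (s m).2 ord0 i.
  move=> /subnK <-; elim: (n - m)%N => [//|k IH].
  by apply: le_trans _ IH; have [] := sS (k + m)%N i.
have s12 m n i : (s m).1 ord0 i <= (s n).2 ord0 i.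
  apply: (le_trans (s1 _ (maxn m n) i (leq_maxl _ _))).
  apply: (le_trans _ (s2 _ (maxn m n) i (leq_maxr _ _))).
  by apply: ltW; have [_] := gs (maxn m n).
have sw n i : (s n).2 ord0 i - (s n).1 ord0 i = (b ord0 i - a ord0 i) / 2 ^+ (if J i then n else 0).
  elim: n => [|n IH]; first by rewrite if_same expr0 divr1.
  have [_ _ ->] := sS n i; rewrite IH; case: (J i); rewrite ?expr0 ?divr1//.
  by rewrite expr1 exprSr invfM mulrA.
exists (\row_i sup [set (s n).1 ord0 i | n in setT]) => n.
exists (s n).1, (s n).2; split; first by have [] := gs n.
move=> i; split; [exact: (s1 0%N)|exact: (s2 0%N)|exact: sw|].
rewrite mxE; apply/andP; split.
  apply: ub_le_sup; last by exists n.
  by exists ((s n).2 ord0 i) => _ [m _ <-].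
by apply: ge_sup; [exists ((s 0%N).1 ord0 i), 0%N|move=> _ [m _ <-]].
Qed.

End Bisection.

(** * Volume of linear and differentiable images *)

Lemma lee_mul_gt1 (R : realType) (x : \bar R) (y : R) : 0 <= y ->
  (forall t, 1 < t -> (x <= (t * y)%:E)%E) -> (x <= y%:E)%E.
Proof.
rewrite le_eqVlt => /predU1P[<- H|y0 H].
  by have := H 2 (ltr1n _ 2); rewrite mulr0.
apply/lee_addgt0Pr => e e0; have := H (1 + e / y).
by rewrite mulrDl mul1r divfK ?gt_eqF// EFinD; apply; rewrite ltrDl divr_gt0.
Qed.

Lemma exists_expr_le (R : realType) (d : nat) (t : R) : 1 < t ->
  exists2 e : R, 0 < e & (1 + e) ^+ d <= t.
Proof.
move=> t1; have /cvgrPdist_lt := @exprn_continuous R d 1.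
move=> /(_ (t - 1)); rewrite subr_gt0 => /(_ t1) /nbhs_ballP[r /= r0] H.
exists (r / 2); first by rewrite divr_gt0.
have /H /= : ball (1 : R) r (1 + r / 2).
  by rewrite /ball/= opprD addrA subrr sub0r normrN gtr0_norm ?divr_gt0//; lra.
by rewrite expr1n ltr_norml => /andP[h _]; lra.
Qed.

Lemma exists_pow2_ge (R : realType) (I : finType) (c e : I -> R) :
  (forall i, 0 < e i) -> exists N : nat, forall i, c i <= e i * 2 ^+ N.
Proof.
move=> e0; pose b i := Num.bound (c i / e i).
exists (\max_i b i)%N => i; rewrite mulrC -ler_pdivrMr// ltW//.
by apply: upper_nthrootP; exact: leq_bigmax.
Qed.

Section LinearImage.
Variables (R : realType) (d : nat).
Hypothesis d_gt0 : (0 < d)%N.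
Implicit Types (a b x y : 'rV[R]_d) (X Y : set 'rV[R]_d).
Local Notation mu := (@lebesgue_outer R d).

Lemma lebesgue_outer0 : mu set0 = 0%E.
Proof.
apply/eqP; rewrite eq_le lebesgue_outer_ge0 andbT.
have : box_volume (0 : 'rV[R]_d) 0 = 0.
  by rewrite /box_volume (bigD1 (Ordinal d_gt0))//= subrr mul0r.
move=> v0; rewrite (@le_trans _ _ (box_volume (0 : 'rV[R]_d) 0)%:E) ?v0//.
by rewrite -v0 (le_trans _ (lebesgue_outer_box d_gt0 _))// le_lebesgue_outer.
Qed.

Lemma lebesgue_outerU_le X Y : (mu (X `|` Y) <= mu X + mu Y)%E.
Proof.
have -> : X `|` Y = \bigcup_n (if n is 0 then X else if n is 1 then Y else set0).
  apply/seteqP; split=> [x [xX|xY]|x [[|[|n]] _ //]]; [by exists 0%N|by exists 1%N|by left|by right].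
apply: le_trans (lebesgue_outer_bigcup_le _) _.
rewrite (@nneseries_split _ _ 0 2)//; last by move=> k _; exact: lebesgue_outer_ge0.
rewrite add0n !big_nat_recr//= big_nil add0e eseries0 ?adde0//.
by move=> [|[|i]]// _ _; exact: lebesgue_outer0.
Qed.

Lemma box_split a b j c : box a b `<=` box a (upd b j c) `|` box (upd a j c) b.
Proof.
move=> x xab; have [xc|cx] := leP (x ord0 j) c; [left|right] => i; have /andP[h1 h2] := xab i.
  by rewrite !mxE h1 /=; case: eqP => [->|].
by rewrite !mxE h2 andbT; case: eqP => [->|//]; exact: ltW.
Qed.

Lemma box_volume_split a b j c :
  box_volume a b = box_volume a (upd b j c) + box_volume (upd a j c) b.
Proof.
rewrite /box_volume (bigD1 j)//= [X in _ = X + _](bigD1 j)//= [X in _ = _ + X](bigD1 j)//=.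
rewrite !mxE eqxx.
rewrite [X in _ = _ * X + _](eq_bigr (fun i => b ord0 i - a ord0 i)); last first.
  by move=> i /negbTE ij; rewrite !mxE ij.
rewrite [X in _ = _ + _ * X](eq_bigr (fun i => b ord0 i - a ord0 i)); last first.
  by move=> i /negbTE ij; rewrite !mxE ij.
by ring.
Qed.

(** Box volume is additive under halving and the outer measure of the image subadditive, so an
    excess cannot be absent from both halves. *)
Lemma bad_image_split (f : 'rV[R]_d -> 'rV[R]_d) (c : R) a b j m :
  ((c * box_volume a b)%:E < mu (f @` box a b))%E ->
  ((c * box_volume a (upd b j m))%:E < mu (f @` box a (upd b j m)))%E \/
  ((c * box_volume (upd a j m) b)%:E < mu (f @` box (upd a j m) b))%E.
Proof.
move=> bad; have [?|h1] := ltP ((c * box_volume a (upd b j m))%:E) (mu (f @` box a (upd b j m))).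
  by left.
have [?|h2] := ltP ((c * box_volume (upd a j m) b)%:E) (mu (f @` box (upd a j m) b)).
  by right.
exfalso; move: bad; apply/negP; rewrite -leNgt (box_volume_split a b j m) mulrDr EFinD.
apply: le_trans (leeD h1 h2); apply: le_trans (lebesgue_outerU_le _ _).
by rewrite -image_setU; apply: le_lebesgue_outer; apply: image_subset; exact: box_split.
Qed.

Lemma lebesgue_outer_image_le (f : 'rV[R]_d -> 'rV[R]_d) (c : R) : 0 < c ->
  (forall a b, (forall i, a ord0 i < b ord0 i) ->
    (mu (f @` box a b) <= (c * box_volume a b)%:E)%E) ->
  forall Y, (mu (f @` Y) <= c%:E * mu Y)%E.
Proof.
move=> c0 H Y.
have [Yoo|Yfin] := eqVneq (mu Y) +oo%E; first by rewrite Yoo gt0_muley ?lte_fin// leey.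
have Yf : mu Y \is a fin_num by rewrite ge0_fin_numE ?lebesgue_outer_ge0// ltey.
apply/lee_addgt0Pr => e e0.
have : (mu Y < mu Y + (e / c)%:E)%E by rewrite lteDl// lte_fin divr_gt0.
move=> /exists_open_cover[a [b [ab Yab sab]]].
apply: (@le_trans _ _ (mu (\bigcup_k (f @` box (a k) (b k))))).
  apply: le_lebesgue_outer => _ [y /Yab[k yk] <-]; exists k => //; exists y => // i.
  by have /andP[/ltW -> /ltW ->] := yk i.
apply: le_trans (lebesgue_outer_bigcup_le _) _.
apply: (@le_trans _ _ (\sum_(0 <= k <oo) (c%:E * (box_volume (a k) (b k))%:E))%E).
  by apply: lee_nneseries => [k _ _|k _]; [exact: lebesgue_outer_ge0|exact: H].
rewrite nneseriesZl; last by move=> k _; rewrite lee_fin box_volume_ge0// => i; exact: ltW.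
have -> : (c%:E * mu Y + e%:E = c%:E * (mu Y + (e / c)%:E))%E.
  rewrite -(fineK Yf) -[in RHS]EFinD -!EFinM -EFinD; congr EFin.
  by rewrite mulrDr; congr (_ + _); rewrite mulrCA divff ?gt_eqF// mulr1.
by rewrite lee_pmul2l// ltW.
Qed.

Definition det_bounded (A : 'M[R]_d) :=
  forall Y, (mu ((fun x => x *m A) @` Y) <= `|\det A|%:E * mu Y)%E.

(* Bisecting coordinate i exactly rk i * N times yields boxes so elongated that
   the off-diagonal entries of A hardly contribute to the image. *)
Lemma det_bounded_triangular (A : 'M[R]_d) (rk : 'I_d -> nat) :
  (forall i, A i i != 0) -> \det A = \prod_i A i i ->
  (forall i j, i != j -> A i j != 0 -> (rk j < rk i)%N) -> det_bounded A.
Proof.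
move=> A0 detA rkA; apply: lebesgue_outer_image_le.
  by rewrite normr_gt0 detA; apply/prodf_neq0 => i _.
move=> a b ab; apply: lee_mul_gt1.
  by rewrite mulr_ge0// box_volume_ge0// => i; exact: ltW.
(* The slack factor [t] leaves room for widening each of the [d] sides by the factor [1 + e]. *)
move=> t t1; have [e e0 et] := exists_expr_le d t1.
rewrite leNgt; apply/negP; rewrite mulrA => bad.
pose s i := b ord0 i - a ord0 i.
have s0 i : 0 < s i by rewrite subr_gt0.
have [j|N HN] := @exists_pow2_ge R 'I_d (fun j => \sum_(i | i != j) s i * `|A i j|)
   (fun j => e / 2 * `|A j j| * s j).
  by rewrite !mulr_gt0 ?divr_gt0 ?normr_gt0.
have [|//|a' [b' [bad' H]]] := @bisect_shape R d predT
    (fun a b => ((t * `|\det A| * box_volume a b)%:E < mu ((fun x => x *m A) @` box a b))%E)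
    _ (fun i => rk i * N)%N _ _ _ ab bad.
  by move=> u v j _ _; exact: bad_image_split.
pose w i := s i / 2 ^+ (rk i * N).
have {}H i : b' ord0 i - a' ord0 i = w i by have [] := H i.
have w0 i : 0 < w i by rewrite divr_gt0 ?exprn_gt0.
pose r j := e / 2 * `|A j j| * w j.
have Hr j : \sum_(i | i != j) w i * `|A i j| <= r j.
  have h1 i : i != j -> w i * `|A i j| <= (s i * `|A i j|) / 2 ^+ (rk j * N + N).
    (* A nonzero entry [A i j] makes [rk i] exceed [rk j], so side [i] is halved at least [N] more
       times than side [j]. *)
    move=> ij; have [->|Aij] := eqVneq (A i j) 0; first by rewrite normr0 !mulr0 mul0r.
    rewrite /w mulrAC; apply: ler_wpM2l; first by rewrite mulr_ge0// ltW.
    rewrite lef_pV2 ?posrE ?exprn_gt0// ler_weXn2l ?ler1n//.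
    by rewrite -mulSnr leq_mul2r (rkA _ _ ij Aij) orbT.
  apply: le_trans (ler_sum _ h1) _.
  rewrite -mulr_suml /r /w mulrA exprD invfM mulrA ler_pdivrMr ?exprn_gt0//.
  rewrite mulrAC; apply: ler_wpM2r; first by rewrite invr_ge0 exprn_ge0.
  exact: HN.
have rE j : r j = e / 2 * `|A j j| * w j by [].
have r0 j : 0 <= r j by rewrite rE !mulr_ge0// ?divr_ge0 ltW.
(* Enclosing box of the image: the diagonal term ranges between 0 and [A j j * w j], of either sign,
   and the off-diagonal terms add at most [r j] on each side. *)
pose l := \row_j ((a' *m A) ord0 j + Num.min 0 (A j j * w j) - r j).
pose u := \row_j ((a' *m A) ord0 j + Num.max 0 (A j j * w j) + r j).
have ul j : u ord0 j - l ord0 j = (1 + e) * `|A j j| * w j.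
  have -> : u ord0 j - l ord0 j = `|A j j * w j| + 2 * r j.
    rewrite !mxE; case: (leP 0 (A j j * w j)) => h; first by rewrite ger0_norm//; lra.
    by rewrite ltr0_norm//; lra.
  by rewrite normrM (gtr0_norm (w0 j)) rE; field.
have lu j : l ord0 j <= u ord0 j.
  rewrite -subr_ge0 ul; apply: mulr_ge0; last exact: ltW (w0 j).
  by apply: mulr_ge0 => //; apply: addr_ge0 => //; exact: ltW.
have sub : (fun x => x *m A) @` box a' b' `<=` box l u.
  move=> _ [x xab <-] j; rewrite !mxE.
  pose z i := x ord0 i - a' ord0 i.
  have zi i : 0 <= z i <= w i.
    have /andP[h1 h2] := xab i; rewrite /z subr_ge0 h1 /=.
    by have := H i; lra.
  have -> : \sum_i x ord0 i * A i j = \sum_i a' ord0 i * A i j + (z j * A j j +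
     \sum_(i | i != j) z i * A i j).
    rewrite [X in _ = _ + X](_ : _ = \sum_i z i * A i j); last by rewrite [RHS](bigD1 j).
    rewrite -big_split/=; apply: eq_bigr => i _; rewrite /z; ring.
  have : `|\sum_(i | i != j) z i * A i j| <= r j.
    apply: le_trans (Hr j); apply: le_trans (ler_norm_sum _ _ _) _.
    apply: ler_sum => i _; rewrite normrM; apply: ler_wpM2r => //.
    by have /andP[h1 h2] := zi i; rewrite ger0_norm.
  rewrite ler_norml => /andP[h1 h2].
  have /andP[z1 z2] := zi j.
  have : Num.min 0 (A j j * w j) <= z j * A j j <= Num.max 0 (A j j * w j).
    have [Aj|Aj] := leP 0 (A j j).
      have g1 := ler_wpM2r Aj z2; have g2 := mulr_ge0 z1 Aj.
      have g3 := mulr_ge0 Aj (ltW (w0 j)).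
      by rewrite (min_idPl g3) (max_idPr g3) g2 [A j j * _]mulrC g1.
    have g1 := ler_wnM2r (ltW Aj) z2; have g2 := mulr_ge0_le0 z1 (ltW Aj).
    have g3 := mulr_le0_ge0 (ltW Aj) (ltW (w0 j)).
    by rewrite (min_idPr g3) (max_idPl g3) g2 [A j j * _]mulrC g1.
  by move=> /andP[m1 m2]; apply/andP; split; lra.
move: bad'; apply/negP; rewrite -leNgt.
apply: le_trans (le_lebesgue_outer sub) _.
apply: le_trans (lebesgue_outer_box d_gt0 lu) _.
rewrite lee_fin /box_volume (eq_bigr _ (fun j _ => ul j)) (eq_bigr _ (fun j _ => H j)).
rewrite !big_split/= prodr_const card_ord -normr_prod -detA.
rewrite -big_split/=; apply: ler_wpM2r.
  by apply: prodr_ge0 => i _; exact: ltW (w0 i).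
by apply: ler_wpM2r.
Qed.

Lemma det_boundedM (A B : 'M[R]_d) : det_bounded A -> det_bounded B ->
  det_bounded (A *m B).
Proof.
move=> hA hB Y; rewrite det_mulmx normrM mulrC EFinM.
have -> : (fun x => x *m (A *m B)) @` Y = (fun x => x *m B) @` ((fun x => x *m A) @` Y).
  by rewrite image_comp; congr (_ @` _); apply/funext => x /=; rewrite mulmxA.
apply: le_trans (hB _) _; rewrite -muleA; apply: lee_wpmul2l; first by rewrite lee_fin.
exact: hA.
Qed.

Lemma det_bounded_perm (s : 'S_d) : det_bounded (perm_mx s).
Proof.
rewrite /det_bounded det_perm normrX normrN1 expr1n.
apply: lebesgue_outer_image_le => // a b ab; rewrite mul1r.
have mE x j : (x *m perm_mx s : 'rV[R]_d) ord0 j = x ord0 ((s^-1)%g j).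
  by rewrite -{1}(invgK s) -col_permE mxE.
have -> : box_volume a b = box_volume (a *m perm_mx s) (b *m perm_mx s).
  rewrite /box_volume (reindex_inj (@perm_inj _ (s^-1)%g)).
  by apply: eq_bigr => j _; rewrite !mE.
apply: le_trans (lebesgue_outer_box d_gt0 _).
  by apply: le_lebesgue_outer => _ [x xab <-] i; rewrite !mE; exact: xab.
by move=> i; rewrite !mE ltW.
Qed.

End LinearImage.

(** LUP decomposition: a permutation maps boxes to boxes, and the triangular factors are ranked by
    the index for the lower one and in reverse order for the upper one. *)
Lemma det_bounded_unitmx (R : realType) (d : nat) (A : 'M[R]_d) : (0 < d)%N ->
  \det A != 0 -> det_bounded A.
Proof.
case: d A => // d A _ detA.
have := cormen_lup_perm A; have := cormen_lup_correct A; have := cormen_lup_detL A.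
have := @cormen_lup_lower _ _ A; have := @cormen_lup_upper _ _ A.
case: (cormen_lup A) => -[P L] U /= hU hL dL PA /is_perm_mxP[s Ps].
have {}PA : P *m A = L *m U := PA.
have UE : \det U = \prod_i U i i.
  rewrite -det_tr det_trig; first by apply: eq_bigr => i _; rewrite mxE.
  by apply/is_trig_mxP => i j ij; rewrite mxE hU.
have U0 i : U i i != 0.
  have : \det U != 0.
    apply: contra_neq detA => U0; apply/eqP.
    have := congr1 determinant PA; rewrite !det_mulmx dL U0 mulr0 => /eqP.
    by rewrite mulf_eq0 Ps det_perm signr_eq0.
  by rewrite UE => /prodf_neq0 /(_ i isT).
have LE : \det L = \prod_i L i i.
  by rewrite dL big1// => i _; rewrite hL// eqxx.
have -> : A = perm_mx (s^-1)%g *m (L *m U).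
  by rewrite -PA Ps mulmxA -perm_mxM mulVg perm_mx1 mul1mx.
apply: det_boundedM => //; first exact: det_bounded_perm.
apply: det_boundedM => //.
- apply: (@det_bounded_triangular _ _ _ _ (fun i => i)) => //.
    by move=> i; rewrite hL// eqxx oner_eq0.
  move=> i j ij; apply: contraNT; rewrite -leqNgt => /hL ->.
  by rewrite (negbTE ij).
- apply: (@det_bounded_triangular _ _ _ _ (fun i => d.+1 - i)%N) => //.
  move=> i j ij; apply: contraNT => h.
  apply/eqP/hU; move: h; rewrite -leqNgt leq_sub2lE; last exact: ltnW.
  by rewrite ltn_neqAle => ->; rewrite andbT eq_sym.
Qed.

Section RowNorm.
Variables (R : realType) (d : nat).
Implicit Types x y : 'rV[R]_d.

Lemma coord_le_norm x i : `|x ord0 i| <= `|x|.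
Proof.
rewrite [leRHS]/Num.Def.normr/= mx_normrE.
exact: (le_bigmax _ (fun ij : 'I_1 * 'I_d => `|x ij.1 ij.2|) (ord0, i)).
Qed.

Lemma row_norm_le x (c : R) : 0 <= c -> (forall i, `|x ord0 i| <= c) -> `|x| <= c.
Proof.
move=> c0 H; rewrite [leLHS]/Num.Def.normr/= mx_normrE (bigmax_le _ c0)//= => -[i j] _ /=.
by rewrite ord1.
Qed.

Lemma differentiable_approx (f : 'rV[R]_d -> 'rV[R]_d) x (e : R) : 0 < e ->
  differentiable f x -> exists2 r : R, 0 < r &
  forall h, `|h| < r -> `|f (x + h) - f x - h *m jacobian f x| <= e * `|h|.
Proof.
move=> e0 /diff_locally df.
set k := 'o _ in df.
have /(littleoP [littleo of k]) /nbhs_ballP[r /= r0 H] := e0.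
exists r => // h hr; have := H h; rewrite -ball_normE /= sub0r normrN => /(_ hr).
have E : f (x + h) = f x + 'd f x h + k h.
  by rewrite addrC; exact: (congr1 (fun g => g h) df).
by rewrite E /jacobian mul_rV_lin1 -addrA -opprD addrAC subrr add0r.
Qed.

End RowNorm.

(** * Images under differentiable maps *)

Section DifferentiableImage.
Variables (R : realType) (d : nat).
Hypothesis d_gt0 : (0 < d)%N.
Local Notation mu := (@lebesgue_outer R d).

(* Bisection towards a point where the volume inequality fails at all scales:
   only pointwise differentiability there is needed, no uniformity. *)
Lemma lebesgue_outer_differentiable_image (f : 'rV[R]_d -> 'rV[R]_d) :
  (forall x, differentiable f x) -> (forall x, `|\det (jacobian f x)| = 1) ->
  forall Y, (mu (f @` Y) <= mu Y)%E.
Proof.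
move=> df detf Y; rewrite -[leRHS]mul1e; apply: lebesgue_outer_image_le => // a b ab.
apply: lee_mul_gt1.
  by rewrite mul1r box_volume_ge0// => i; exact: ltW.
move=> t t1; have [e e0 et] := exists_expr_le d t1.
rewrite leNgt; apply/negP; rewrite mul1r => bad.
have [|x Hx] := @bisect_nested R d predT
    (fun a b => ((t * box_volume a b)%:E < mu (f @` box a b))%E) _ a b ab bad.
  by move=> u v j _ _; exact: bad_image_split.
pose s i := b ord0 i - a ord0 i.
have s0 i : 0 < s i by rewrite subr_gt0.
pose S := \sum_i s i.
have S0 : 0 < S.
  by rewrite /S (bigD1 (Ordinal d_gt0))//= ltr_pwDl// sumr_ge0// => i _; exact: ltW.
have sS i : s i <= S.
  by rewrite /S (bigD1 i)//= lerDl sumr_ge0// => j _; exact: ltW.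
set A := jacobian f x.
have A0 : \det A != 0 by rewrite -normr_gt0 detf.
have Au : A \in unitmx by rewrite unitmxE unitfE.
pose C j : R := \sum_i `|invmx A i j|.
have C0 j : 0 <= C j by apply: sumr_ge0.
(* [eta] is the linearization error per unit length; pulled back by the inverse of [A], it must stay
   within half of the margin [e] on every side. All sides shrink by the same factor, so the
   condition is independent of the scale. *)
have [eta eta0 Heta] : exists2 eta : R, 0 < eta & forall j, eta * S * C j <= e / 2 * s j.
  have [j|N HN] := @exists_pow2_ge R 'I_d (fun j => S * C j) (fun j => e / 2 * s j).
    by rewrite mulr_gt0 ?divr_gt0.
  exists (2 ^- N); first by rewrite invr_gt0 exprn_gt0.
  by move=> j; rewrite -mulrA ler_pdivrMl ?exprn_gt0// [leRHS]mulrC.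
have [r r0 Hr] := differentiable_approx eta0 (df x).
have [_|N HN] := @exists_pow2_ge R 'I_1 (fun=> 2 * S) (fun=> r); first by [].
have {}HN := HN ord0.
have {HN}SN : S / 2 ^+ N < r.
  by rewrite ltr_pdivrMr ?exprn_gt0//; lra.
have [a' [b' [/= bad' H]]] := Hx N.
pose w i := s i / 2 ^+ N.
have w0 i : 0 < w i by rewrite divr_gt0 ?exprn_gt0.
have wE i : b' ord0 i - a' ord0 i = w i by have [] := H i.
have {}Hx i : a' ord0 i <= x ord0 i <= b' ord0 i by have [] := H i.
pose l := \row_i (a' ord0 i - x ord0 i - e / 2 * w i).
pose u := \row_i (b' ord0 i - x ord0 i + e / 2 * w i).
have ul i : u ord0 i - l ord0 i = (1 + e) * w i.
  by rewrite !mxE -wE; field.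
have lu i : l ord0 i <= u ord0 i.
  by rewrite -subr_ge0 ul mulr_ge0 ?(ltW (w0 i))// addr_ge0// ltW.
(* The error is absorbed before [A] acts: [f y - f x] is the image under [A] of
   [h + err *m invmx A], a point of a slightly larger box. The linear case then gives the volume. *)
have sub : f @` box a' b' `<=` (fun z => z + f x) @` ((fun z => z *m A) @` box l u).
  move=> _ [y yab <-].
  pose h := y - x.
  have hw i : `|h ord0 i| <= w i.
    rewrite !mxE ler_norml; have := Hx i; have := yab i; have := wE i; lra.
  have hS : `|h| <= S / 2 ^+ N.
    apply: row_norm_le => [|i]; first by rewrite divr_ge0 ?exprn_ge0// ltW.
    by apply: le_trans (hw i) _; rewrite ler_wpM2r// invr_ge0 exprn_ge0.
  pose err := f y - f x - h *m A.
  have errS : `|err| <= eta * (S / 2 ^+ N).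
    have xh : x + h = y by rewrite /h addrC subrK.
    have := Hr h (le_lt_trans hS SN); rewrite xh => /le_trans; apply.
    by apply: ler_wpM2l => //; exact: ltW.
  exists ((h + err *m invmx A) *m A); last first.
    by rewrite mulmxDl -mulmxA mulVmx// mulmx1 /err [h *m A + _]addrC !subrK.
  exists (h + err *m invmx A) => // i.
  have : `|(err *m invmx A) ord0 i| <= e / 2 * w i.
    rewrite mxE; apply: le_trans (ler_norm_sum _ _ _) _.
    apply: (@le_trans _ _ (\sum_j (eta * (S / 2 ^+ N)) * `|invmx A j i|)).
      apply: ler_sum => j _; rewrite normrM; apply: ler_wpM2r => //.
      exact: le_trans (coord_le_norm _ _) errS.
    rewrite -mulr_sumr -/(C i) /w [leRHS]mulrA.
    have -> : eta * (S / 2 ^+ N) * C i = eta * S * C i / 2 ^+ N by ring.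
    by apply: ler_wpM2r => //; rewrite invr_ge0 exprn_ge0.
  rewrite ler_norml => /andP[h1 h2].
  have := yab i; rewrite !mxE; move: h1 h2; rewrite mxE; lra.
move: bad'; apply/negP; rewrite -leNgt.
apply: le_trans (le_lebesgue_outer sub) _.
apply: le_trans (lebesgue_outer_translate _ _) _.
apply: le_trans (det_bounded_unitmx d_gt0 A0 _) _.
rewrite detf mul1e; apply: le_trans (lebesgue_outer_box d_gt0 lu) _.
rewrite lee_fin /box_volume (eq_bigr _ (fun j _ => ul j)) (eq_bigr _ (fun j _ => wE j)).
rewrite big_split/= prodr_const card_ord; apply: ler_wpM2r => //.
by apply: prodr_ge0 => i _; exact: ltW (w0 i).
Qed.

End DifferentiableImage.

(** * Steiner symmetrization *)

Section Steiner.
Variables (R : realType) (d : nat) (i0 : 'I_d).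
Implicit Types (a b u v x y : 'rV[R]_d) (K : set 'rV[R]_d).
Local Notation mu := (@lebesgue_outer R d).

(** Each vertical fibre is replaced by half of its difference set, which for an interval is a
    centred interval of the same length. In this form the points of the symmetral are midpoints
    between a point of [K] and the mirror image of another one on the same vertical line, as the
    estimate of support functions requires. *)
Definition steiner K : set 'rV[R]_d :=
  [set x | exists a b, [/\ K a, K b,
     forall j, j != i0 -> a ord0 j = x ord0 j /\ b ord0 j = x ord0 j &
     x ord0 i0 = (a ord0 i0 - b ord0 i0) / 2]].

Let d_gt0 : (0 < d)%N.
Proof. by case: d i0 => [[]|]. Qed.

Definition clamp (a b t : R) := Num.max a (Num.min b t).

(** For [a <= b] and [c <= e], the length of the intersection of the two intervals. As an increment
    of the monotone function [clamp a b] it is additive when the second interval is subdivided. *)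
Definition overlap (a b c e : R) := Num.max 0 (clamp a b e - clamp a b c).

Lemma clamp_le (a b s t : R) : s <= t -> clamp a b s <= clamp a b t.
Proof.
move=> st; rewrite /clamp ge_max !le_max lexx /=.
by rewrite [X in _ || X]le_min !ge_min lexx st !orbT.
Qed.

Lemma overlap_ge0 (a b c e : R) : 0 <= overlap a b c e.
Proof. by rewrite le_max lexx. Qed.

Lemma overlap_split (a b c m e : R) : c <= m -> m <= e ->
  overlap a b c e = overlap a b c m + overlap a b m e.
Proof.
move=> cm me; rewrite /overlap !(max_idPr _) ?subr_ge0 ?clamp_le//; last exact: le_trans me.
by ring.
Qed.

Lemma overlap_le (a b c e : R) : a <= b -> overlap a b c e <= b - a.
Proof.
move=> ab; rewrite ge_max subr_ge0 ab /=; apply: lerB.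
  by rewrite ge_max ab ge_min lexx.
by rewrite le_max lexx.
Qed.

Lemma overlap_sub (a b c e : R) : a <= c -> c <= e -> e <= b -> overlap a b c e = e - c.
Proof.
move=> ac ce eb; rewrite /overlap /clamp (min_idPr eb) (min_idPr (le_trans ce eb)).
rewrite (max_idPr ac) (max_idPr (le_trans ac ce)).
by apply/max_idPr; rewrite subr_ge0.
Qed.

Definition base_volume a b : R := \prod_(j | j != i0) (b ord0 j - a ord0 j).

Lemma base_volume_split a b j c : j != i0 ->
  base_volume a b = base_volume a (upd b j c) + base_volume (upd a j c) b.
Proof.
move=> ji; rewrite /base_volume !(bigD1 j ji)/= !mxE eqxx.
rewrite [X in _ = _ * X + _](eq_bigr (fun i => b ord0 i - a ord0 i)); last first.
  by move=> i /andP[_ /negbTE ij]; rewrite !mxE ij.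
rewrite [X in _ = _ + _ * X](eq_bigr (fun i => b ord0 i - a ord0 i)); last first.
  by move=> i /andP[_ /negbTE ij]; rewrite !mxE ij.
by ring.
Qed.

(* Volume of the part of the box [u, v] lying over the base of the box [a, b]. *)
Definition cylinder_part u v a b : R := (v ord0 i0 - u ord0 i0) *
  \prod_(j | j != i0) overlap (u ord0 j) (v ord0 j) (a ord0 j) (b ord0 j).

Lemma cylinder_part_ge0 u v a b : u ord0 i0 <= v ord0 i0 -> 0 <= cylinder_part u v a b.
Proof.
move=> uv; rewrite mulr_ge0 ?subr_ge0//; apply: prodr_ge0 => j _; exact: overlap_ge0.
Qed.

Lemma cylinder_part_split u v a b j c : j != i0 -> a ord0 j <= c -> c <= b ord0 j ->
  cylinder_part u v a b = cylinder_part u v a (upd b j c) + cylinder_part u v (upd a j c) b.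
Proof.
move=> ji ac cb; rewrite /cylinder_part !(bigD1 j ji)/= !mxE eqxx.
rewrite [X in _ = _ * (_ * X) + _](eq_bigr (fun i =>
    overlap (u ord0 i) (v ord0 i) (a ord0 i) (b ord0 i))); last first.
  by move=> i /andP[_ /negbTE ij]; rewrite !mxE ij.
rewrite [X in _ = _ + _ * (_ * X)](eq_bigr (fun i =>
    overlap (u ord0 i) (v ord0 i) (a ord0 i) (b ord0 i))); last first.
  by move=> i /andP[_ /negbTE ij]; rewrite !mxE ij.
by rewrite (@overlap_split _ _ _ c)//; ring.
Qed.

Lemma cylinder_part_le u v a b : (forall i, u ord0 i <= v ord0 i) ->
  cylinder_part u v a b <= box_volume u v.
Proof.
move=> uv; rewrite /cylinder_part /box_volume [leRHS](bigD1 i0)//=.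
apply: ler_wpM2l; first by rewrite subr_ge0.
by apply: ler_prod => j _; rewrite overlap_ge0 overlap_le.
Qed.

(** The open cover of the symmetral, cut along the vertical line over [x], covers an open interval
    as long as the fibre of [K]; subadditivity of one-dimensional Lebesgue measure bounds that
    length. [al] and [be] are the infimum and supremum of the fibre, or both 0 if it is empty. *)
Lemma fiber_length K x (a b : nat -> 'rV[R]_d) : bounded_set K ->
  (forall y s r t, K (upd y i0 s) -> K (upd y i0 t) -> s <= r <= t -> K (upd y i0 r)) ->
  (forall k i, a k ord0 i < b k ord0 i) ->
  (forall y, steiner K y -> exists k, forall i, a k ord0 i < y ord0 i < b k ord0 i) ->
  exists al be, [/\ al <= be, forall t, K (upd x i0 t) -> al <= t <= be &
    ((be - al)%:E <= \sum_(0 <= k <oo)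
      (if `[< forall j, j != i0 -> (a k ord0 j < x ord0 j < b k ord0 j)%R >]
       then b k ord0 i0 - a k ord0 i0 else 0)%:E)%E].
Proof.
move=> [M [_ /(_ (M + 1))]]; rewrite ltrDl ltr01 => /(_ isT) KM Kv ab Sab.
have s0 k : (0%:E <= (if `[< forall j, j != i0 -> (a k ord0 j < x ord0 j < b k ord0 j)%R >]
       then b k ord0 i0 - a k ord0 i0 else 0)%:E)%E.
  by case: ifP => // _; rewrite lee_fin subr_ge0 ltW.
pose F := [set t | K (upd x i0 t)].
have [/set0P F0|F0] := pselect (F != set0); last first.
  exists 0, 0; split => // [t Ft|]; last by rewrite subrr nneseries_ge0.
  by exfalso; apply: F0; apply/set0P; exists t.
have FM t : F t -> `|t| <= M + 1.
  move=> /KM /=; apply: le_trans.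
  by apply: le_trans (coord_le_norm _ i0); rewrite mxE eqxx.
have ubF : has_ubound F by exists (M + 1) => t /FM; rewrite ler_norml => /andP[].
have lbF : has_lbound F by exists (- (M + 1)) => t /FM; rewrite ler_norml => /andP[].
have le1 t : F t -> inf F <= t <= sup F.
  by move=> Ft; rewrite ge_inf// ub_le_sup.
exists (inf F), (sup F); split => //.
  by have [t /le1/andP[h1 h2]] := F0; exact: le_trans h2.
pose l := (sup F - inf F) / 2.
pose G k : set R := if `[< forall j, j != i0 -> (a k ord0 j < x ord0 j < b k ord0 j)%R >]
  then `]a k ord0 i0, b k ord0 i0[%classic else set0.
have cov : `]-l, l[%classic `<=` \bigcup_k G k.
  move=> r /=; rewrite in_itv/= => /andP[r1 r2].
  have [s [t [Fs Ft st]]] : exists s t, [/\ F s, F t & 2 * `|r| < s - t].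
    have : 2 * `|r| < sup F - inf F.
      have : `|r| < l by rewrite ltr_norml r1 r2.
      by rewrite /l; lra.
    move=> h; pose e := (sup F - inf F - 2 * `|r|) / 2.
    have e0 : 0 < e by rewrite /e divr_gt0// subr_gt0.
    have [s Fs hs] := sup_adherent e0 (conj F0 ubF).
    have [t Ft ht] := inf_adherent e0 (conj F0 lbF).
    exists s, t; split => //; move: hs ht; rewrite /e; lra.
  have Sr : steiner K (upd x i0 r).
    (* The height [r] is half the difference of [t] and a point at distance 2|r| above it, which is
       still below [s] and hence in the fibre by convexity; the sign of [r] decides the order. *)
    have [r0|r0] := leP 0 r.
      exists (upd x i0 (t + 2 * r)), (upd x i0 t); split => //.
      - apply: (Kv x t _ s) => //; move: st; rewrite ger0_norm//; lra.
      - by move=> j /negbTE ji; rewrite !mxE ji.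
      - by rewrite !mxE eqxx; field.
    exists (upd x i0 t), (upd x i0 (t - 2 * r)); split => //.
    - apply: (Kv x t _ s) => //; move: st; rewrite ltr0_norm//; lra.
    - by move=> j /negbTE ji; rewrite !mxE ji.
    - by rewrite !mxE eqxx; field.
  have [k Hk] := Sab _ Sr; exists k => //; rewrite /G; case: asboolP => [_|].
    by have := Hk i0; rewrite mxE eqxx /= in_itv.
  by case=> j ji; have := Hk j; rewrite mxE (negbTE ji).
have mG k : measurable (G k) by rewrite /G; case: ifP.
have -> : (sup F - inf F)%:E = lebesgue_measure (`]-l, l[%classic : set R) :> \bar R.
  rewrite lebesgue_measure_itv/= lte_fin.
  have := le1; have [t /le1/andP[h1 h2]] := F0 => _.
  case: ltP => h; first by rewrite -EFinB /l; congr EFin; field.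
  by congr EFin; move: h; rewrite /l; lra.
apply: (le_trans (@measure_sigma_subadditive _ _ _ (@lebesgue_measure R) _ _ mG _ cov)); first exact: measurable_itv.
apply: lee_nneseries => // k _; rewrite /G; case: ifP => _; last by rewrite measure0.
by rewrite [leLHS](lebesgue_measure_itv `]a k ord0 i0, b k ord0 i0[)/= lte_fin ab EFinB.
Qed.

(** By compactness, the points of [K] whose height leaves the enlarged interval keep a positive
    horizontal distance from the vertical line over [x]. *)
Lemma fiber_upper_semicontinuous K x al be e : compact K -> 0 < e -> al <= be ->
  (forall t, K (upd x i0 t) -> al <= t <= be) ->
  exists2 r : R, 0 < r & forall y, K y -> (forall j, j != i0 -> `|y ord0 j - x ord0 j| <= r) ->
    al - e <= y ord0 i0 <= be + e.
Proof.
move=> Kc e0 alb Kx.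
pose C := [set y : 'rV[R]_d | y ord0 i0 <= al - e] `|` [set y | be + e <= y ord0 i0].
have Cc : closed C.
  apply: closedU.
    by apply: (@closed_comp _ _ (fun y : 'rV[R]_d => y ord0 i0) [set t | t <= al - e]);
      [move=> y _; exact: coord_continuous|exact: closed_le].
  by apply: (@closed_comp _ _ (fun y : 'rV[R]_d => y ord0 i0) [set t | be + e <= t]);
      [move=> y _; exact: coord_continuous|exact: closed_ge].
have K2c : compact (K `&` C) by apply: compact_closedI.
have [/set0P K20|K20] := pselect (K `&` C != set0); last first.
  exists 1 => // y Ky _; apply: contrapT => /negP; rewrite negb_and -!ltNge => h.
  apply: K20; apply/set0P; exists y; split => //.
  by case/orP: h => /ltW; [left|right].
pose g (y : 'rV[R]_d) : R := \sum_(j | j != i0) `|y ord0 j - x ord0 j|.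
have gc : continuous g.
  apply: continuous_big; first exact: add_continuous.
  move=> j _ y.
  have h : (z ord0 j - x ord0 j) @[z --> nbhs y] --> (y ord0 j - x ord0 j).
    by apply: cvgB; [exact: coord_continuous|exact: cvg_cst].
  exact: (cvg_norm h).
have [c /set_mem[Kc' Cc'] Hc] := EVT_min_rV K20 K2c (continuous_subspaceT gc).
have gc0 : 0 < g c.
  rewrite lt_neqAle; apply/andP; split; last by apply: sumr_ge0.
  apply/negP => /eqP/esym/eqP; rewrite psumr_eq0// => /allP h.
  have cE : c = upd x i0 (c ord0 i0).
    apply/rowP => j; rewrite mxE; case: eqP => [->//|/eqP ji].
    by have := h j (mem_index_enum _); rewrite ji /= normr_eq0 subr_eq0 => /eqP.
  have := Kx (c ord0 i0); rewrite -cE => /(_ Kc').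
  by case: Cc' => /=; lra.
(* If every horizontal coordinate is this close, the sum [g] is at most [g c / 2], below its minimum
   over the excluded points. *)
exists (g c / (2 * d%:R)).
  by rewrite divr_gt0// mulr_gt0// ltr0n.
move=> y Ky hy; apply: contrapT => /negP; rewrite negb_and -!ltNge => h.
have /mem_set/Hc : (K `&` C) y.
  by split => //; case/orP: h => /ltW; [left|right].
apply/negP; rewrite -ltNge; apply: (@le_lt_trans _ _ (g c / 2)); last by lra.
apply: (@le_trans _ _ (\sum_(j < d) g c / (2 * d%:R))).
  rewrite /g [leLHS]big_mkcond; apply: ler_sum => j _; case: ifP => [/hy//|_].
  by rewrite divr_ge0// ?ltW// mulr_gt0// ltr0n.
rewrite sumr_const card_ord -mulr_natr le_eqVlt; apply/orP; left; apply/eqP.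
by field; rewrite pnatr_eq0 -lt0n.
Qed.

(** Fubini by bisection of the base. An excess of volume in [K] would persist in arbitrarily thin
    vertical cylinders around the line over some [x]. There [K] is hardly longer than its fibre over
    [x], by semicontinuity, while the cover of the symmetral contributes almost at least that
    length. *)
Lemma lebesgue_outer_steiner K : compact K ->
  (forall y s r t, K (upd y i0 s) -> K (upd y i0 t) -> s <= r <= t -> K (upd y i0 r)) ->
  (mu K <= mu (steiner K))%E.
Proof.
move=> Kc Kv; have Kb := compact_bounded Kc.
have [->|] := eqVneq (mu (steiner K)) +oo%E; first by rewrite leey.
move=> Sfin.
have Sf : mu (steiner K) \is a fin_num by rewrite ge0_fin_numE ?lebesgue_outer_ge0// ltey.
apply/lee_addgt0Pr => e0 e00.
have : (mu (steiner K) < mu (steiner K) + e0%:E)%E by rewrite lteDl// lte_fin.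
move=> /exists_open_cover[a [b [ab Sab /ltW sab]]]; apply: le_trans sab.
have [M M0 KM] : exists2 M : R, 0 < M & forall y, K y -> forall i, - M <= y ord0 i <= M.
  have [M [_ /(_ (`|M| + 1))]] := Kb.
  rewrite (le_lt_trans (ler_norm _)) ?ltrDl// => /(_ isT) KM.
  exists (`|M| + 1) => [|y /KM/= yM i]; first by rewrite ltr_wpDl.
  by rewrite -ler_norml (le_trans (coord_le_norm _ _)).
pose lo : 'rV[R]_d := const_mx (- M); pose hi : 'rV[R]_d := const_mx M.
have lohi i : lo ord0 i < hi ord0 i by rewrite !mxE; lra.
pose tau u v : \bar R := (\sum_(0 <= k <oo) (cylinder_part (a k) (b k) u v)%:E)%E.
have cyl0 k u v : (0 <= (cylinder_part (a k) (b k) u v)%:E)%E.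
  by rewrite lee_fin cylinder_part_ge0// ltW.
have bv0 u v : (forall i, u ord0 i < v ord0 i) -> 0 < base_volume u v.
  by move=> uv; apply: prodr_gt0 => j _; rewrite subr_gt0.
(* The tolerance is proportional to the base volume, hence additive under bisection like [tau];
   division by the base volume of the initial box makes it arbitrarily small. *)
suff main e : 0 < e -> (mu (K `&` box lo hi) <= tau lo hi + (e * base_volume lo hi)%:E)%E.
  have KE : K = K `&` box lo hi.
    apply/seteqP; split=> [y Ky|y []//]; split => // i; rewrite !mxE; exact: KM.
  apply/lee_addgt0Pr => e e1.
  have := main (e / base_volume lo hi); rewrite divr_gt0 ?bv0// => /(_ isT).
  rewrite -KE divfK ?gt_eqF ?bv0// => /le_trans; apply; apply: leeD => //.
  apply: lee_nneseries => // k _; rewrite lee_fin cylinder_part_le// => i; exact: ltW.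
move=> e1; rewrite leNgt; apply/negP => bad.
have [u v j ji uv|x Hx] := @bisect_nested R d (fun j => j != i0)
  (fun u v => (tau u v + (e * base_volume u v)%:E < mu (K `&` box u v))%E) _ lo hi lohi bad.
  move=> buv; set m := midpt u v j.
  have um : u ord0 j <= m by rewrite /m /midpt; have := uv j; lra.
  have mv : m <= v ord0 j by rewrite /m /midpt; have := uv j; lra.
  have [|h1] := ltP (tau u (upd v j m) + (e * base_volume u (upd v j m))%:E)%E
     (mu (K `&` box u (upd v j m))); first by left.
  have [|h2] := ltP (tau (upd u j m) v + (e * base_volume (upd u j m) v)%:E)%E
     (mu (K `&` box (upd u j m) v)); first by right.
  exfalso; move: buv; apply/negP; rewrite -leNgt.
  have -> : tau u v = (tau u (upd v j m) + tau (upd u j m) v)%E.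
    rewrite /tau -nneseriesD//; apply: eq_eseriesr => k _.
    by rewrite (cylinder_part_split _ _ ji um mv) EFinD.
  rewrite (base_volume_split _ _ m ji) mulrDr EFinD addeACA.
  apply: le_trans (leeD h1 h2); apply: le_trans (lebesgue_outerU_le d_gt0 _ _).
  by apply: le_lebesgue_outer => y [Ky /(@box_split _ _ _ _ j m)[]]; [left|right].
have [al [be [alb Fx lenG]]] := fiber_length x Kb Kv ab Sab.
(* Three [eta] are spent: one at each end of the fibre of [K], one for truncating the series. *)
pose eta := e / 4.
have eta0 : 0 < eta by rewrite divr_gt0.
have [r r0 Hr] := fiber_upper_semicontinuous Kc eta0 alb Fx.
pose G k := `[< forall j, j != i0 -> (a k ord0 j < x ord0 j < b k ord0 j)%R >].
pose g k : R := if G k then b k ord0 i0 - a k ord0 i0 else 0.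
have g0 k : 0 <= g k by rewrite /g; case: ifP => // _; rewrite subr_ge0 ltW.
have [N HN] : exists N, be - al - eta <= \sum_(0 <= k < N) g k.
  apply: contrapT => /forallNP h.
  have : ((be - al)%:E <= (be - al - eta)%:E)%E.
    apply: le_trans lenG _; apply: lime_le.
      by apply: is_cvg_nneseries => k _ _; rewrite lee_fin; exact: g0.
    by apply: nearW => N; rewrite sumEFin lee_fin ltW// ltNge; exact/negP/h.
  by rewrite lee_fin; lra.
(* Bounds for the width of the base cell: the radius [r] of semicontinuity, and the distances from
   [x] to the lateral faces of those among the first [N] boxes whose base contains [x]. A thinner
   cell lies in the base of each of these boxes. The value 1 is a filler for the other indices. *)
pose marg (p : option ('I_N * 'I_d)) : R := if p is Some (k, j) then
   if G k && (j != i0) then Num.min (x ord0 j - a k ord0 j) (b k ord0 j - x ord0 j) else 1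
   else r.
have [[[k j]|]//=|n Hn] := @exists_pow2_ge R _ (fun=> 2 * M) marg.
  case: ifP => // /andP[/asboolP Gk ji]; rewrite lt_min !subr_gt0; exact: Gk.
have [u [v [buv H]]] := Hx n.
have w0 : 0 <= 2 * M / 2 ^+ n by rewrite divr_ge0 ?exprn_ge0// mulr_ge0// ltW.
have wj j : j != i0 -> v ord0 j - u ord0 j = 2 * M / 2 ^+ n.
  by move=> ji; have [_ _ -> _] := H j; rewrite ji !mxE; congr (_ / _); lra.
have Hn' p : 2 * M / 2 ^+ n <= marg p by rewrite ler_pdivrMr ?exprn_gt0.
have uv j : u ord0 j < v ord0 j.
  rewrite -subr_gt0; have [_ _ -> _] := H j.
  by rewrite divr_gt0 ?exprn_gt0// subr_gt0.
have bvpos := bv0 _ _ uv.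
have muK : (mu (K `&` box u v) <= ((be - al + 2 * eta) * base_volume u v)%:E)%E.
  apply: (@le_trans _ _ (mu (box (upd u i0 (al - eta)) (upd v i0 (be + eta))))).
    apply: le_lebesgue_outer => y [Ky yuv] j; rewrite !mxE; case: eqP => [->|_]; last exact: yuv.
    apply: Hr => // k ki.
    have := Hn' None => /=; have [_ _ _] := H k; have := yuv k; have := wj k ki.
    rewrite ler_norml; lra.
  apply: le_trans (lebesgue_outer_box d_gt0 _) _.
    by move=> j; rewrite !mxE; case: eqP => [_|_]; [lra|exact: ltW].
  rewrite lee_fin /box_volume (bigD1 i0)//= !mxE eqxx /base_volume.
  rewrite (eq_bigr (fun j => v ord0 j - u ord0 j)); last first.
    by move=> j /negbTE ji; rewrite !mxE ji.
  by apply: ler_wpM2r; [exact: ltW|lra].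
have tauN : (((be - al - eta) * base_volume u v)%:E <= tau u v)%E.
  apply: (@le_trans _ _ (\sum_(0 <= k < N) (cylinder_part (a k) (b k) u v)%:E)%E); last first.
    by apply: nneseries_lim_ge => k _ _; exact: cyl0.
  rewrite sumEFin lee_fin; apply: (@le_trans _ _ ((\sum_(0 <= k < N) g k) * base_volume u v)).
    by apply: ler_wpM2r => //; exact: ltW.
  rewrite mulr_suml !big_mkord; apply: ler_sum => k _.
  rewrite /g; case: ifP => Gk; last first.
    by rewrite mul0r -lee_fin; exact: cyl0.
  rewrite /cylinder_part /base_volume; apply/ler_wpM2l; first by rewrite subr_ge0 ltW.
  apply: ler_prod => j ji; rewrite subr_ge0 (ltW (uv j)) /= overlap_sub//.
  - have := Hn' (Some (k, j)); rewrite /= Gk ji /= le_min => /andP[].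
    by have [_ _ _] := H j; have := wj j ji; lra.
  - exact: ltW.
  - have := Hn' (Some (k, j)); rewrite /= Gk ji /= le_min => /andP[].
    by have [_ _ _] := H j; have := wj j ji; lra.
move: buv; apply/negP; rewrite -leNgt; apply: le_trans muK _.
apply: le_trans (leeD2r _ tauN); rewrite -EFinD lee_fin -mulrDl.
by apply: ler_wpM2r; [exact: ltW|rewrite /eta; lra].
Qed.

End Steiner.

(** * Euclidean geometry *)

Section Euclidean.
Variables (R : realType) (d : nat).
Implicit Types (u v w x y : 'rV[R]_d) (a b : R).

Lemma dotvE u v : dotv u v = (u *m v^T) ord0 ord0.
Proof. by rewrite mxE; apply: eq_bigr => i _; rewrite mxE. Qed.

Lemma dotvC u v : dotv u v = dotv v u.
Proof. by apply: eq_bigr => i _; rewrite mulrC. Qed.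

Lemma dotvDl u v w : dotv (u + v) w = dotv u w + dotv v w.
Proof. by rewrite !dotvE mulmxDl mxE. Qed.

Lemma dotvZl a u v : dotv (a *: u) v = a * dotv u v.
Proof. by rewrite !dotvE -scalemxAl mxE. Qed.

Lemma dotvNl u v : dotv (- u) v = - dotv u v.
Proof. by rewrite -scaleN1r dotvZl mulN1r. Qed.

Lemma dotvBl u v w : dotv (u - v) w = dotv u w - dotv v w.
Proof. by rewrite dotvDl dotvNl. Qed.

Lemma dotvDr u v w : dotv u (v + w) = dotv u v + dotv u w.
Proof. by rewrite !(dotvC u) dotvDl. Qed.

Lemma dotvZr a u v : dotv u (a *: v) = a * dotv u v.
Proof. by rewrite !(dotvC u) dotvZl. Qed.

Lemma dotvNr u v : dotv u (- v) = - dotv u v.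
Proof. by rewrite !(dotvC u) dotvNl. Qed.

Lemma dotvBr u v w : dotv u (v - w) = dotv u v - dotv u w.
Proof. by rewrite !(dotvC u) dotvBl. Qed.

Lemma dot0v u : dotv 0 u = 0.
Proof. by rewrite -(scale0r u) dotvZl mul0r. Qed.

Lemma dotv_mulmx u v (Q : 'M[R]_d) : dotv (u *m Q) v = dotv u (v *m Q^T).
Proof. by rewrite !dotvE trmx_mul trmxK mulmxA. Qed.

Lemma dotv_delta u i : dotv u (delta_mx ord0 i) = u ord0 i.
Proof.
rewrite /dotv (bigD1 i)//= mxE !eqxx mulr1 big1 ?addr0// => j ji.
by rewrite mxE (negbTE ji) andbF mulr0.
Qed.

Lemma dotvv_ge0 u : 0 <= dotv u u.
Proof. by apply: sumr_ge0 => i _; rewrite -expr2 sqr_ge0. Qed.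

Lemma dotvv_eq0 u : (dotv u u == 0) = (u == 0).
Proof.
apply/idP/eqP => [|->]; last by rewrite dot0v.
rewrite psumr_eq0 => [/allP h|i _]; last by rewrite -expr2 sqr_ge0.
apply/rowP => i; have := h i (mem_index_enum _).
by rewrite /= mulf_eq0 orbb mxE => /eqP.
Qed.

Lemma enorm_ge0 u : 0 <= enorm u.
Proof. exact: sqrtr_ge0. Qed.

Lemma sqr_enorm u : enorm u ^+ 2 = dotv u u.
Proof. by rewrite sqr_sqrtr ?dotvv_ge0. Qed.

Lemma enorm_eq0 u : (enorm u == 0) = (u == 0).
Proof. by rewrite -sqrf_eq0 sqr_enorm dotvv_eq0. Qed.

Lemma enorm0 : enorm (0 : 'rV[R]_d) = 0.
Proof. by apply/eqP; rewrite enorm_eq0. Qed.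

Lemma enorm_gt0 u : (0 < enorm u) = (u != 0).
Proof. by rewrite lt_neqAle enorm_ge0 andbT eq_sym enorm_eq0. Qed.

Lemma enormZ a u : enorm (a *: u) = `|a| * enorm u.
Proof. by rewrite /enorm dotvZl dotvZr mulrA -expr2 sqrtrM ?sqr_ge0// sqrtr_sqr. Qed.

Lemma enormN u : enorm (- u) = enorm u.
Proof. by rewrite -scaleN1r enormZ normrN1 mul1r. Qed.

Lemma enormBC u v : enorm (u - v) = enorm (v - u).
Proof. by rewrite -enormN opprB. Qed.

Lemma esphereP u : esphere R d u <-> dotv u u = 1.
Proof.
split=> [/= h|h]; first by rewrite -sqr_enorm h expr1n.
by rewrite /esphere /= /enorm h sqrtr1.
Qed.

Lemma cauchy_schwarz u v : `|dotv u v| <= enorm u * enorm v.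
Proof.
rewrite -(@ler_pXn2r _ 2)// ?nnegrE ?mulr_ge0 ?enorm_ge0//.
rewrite real_normK ?num_real// exprMn !sqr_enorm.
have [->|v0] := eqVneq v 0; first by rewrite !(dotvC _ 0) !dot0v expr0n/= mulr0.
have vv : 0 < dotv v v by rewrite lt_neqAle eq_sym dotvv_eq0 v0 dotvv_ge0.
have := dotvv_ge0 (dotv v v *: u - dotv u v *: v).
rewrite !dotvBl !dotvBr !dotvZl !dotvZr (dotvC v u).
set A := dotv u u; set B := dotv u v; set D := dotv v v in vv *.
set P := (X in 0 <= X); have -> : P = D * (A * D - B ^+ 2) by rewrite /P; ring.
by rewrite pmulr_rge0// subr_ge0.
Qed.

Lemma dotv_le u v : dotv u v <= enorm u * enorm v.
Proof. exact: le_trans (ler_norm _) (cauchy_schwarz _ _). Qed.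

Lemma enormD_le u v : enorm (u + v) <= enorm u + enorm v.
Proof.
rewrite -(@ler_pXn2r _ 2)// ?nnegrE ?addr_ge0 ?enorm_ge0//.
rewrite sqrrD !sqr_enorm dotvDl !dotvDr (dotvC v u).
by have := dotv_le u v; lra.
Qed.

Lemma coord_le_enorm u i : `|u ord0 i| <= enorm u.
Proof.
rewrite -dotv_delta (le_trans (cauchy_schwarz _ _))//.
by rewrite {2}/enorm dotv_delta mxE !eqxx sqrtr1 mulr1.
Qed.

Lemma enorm_le_norm u : enorm u <= d%:R * `|u|.
Proof.
rewrite -(@ler_pXn2r _ 2)// ?nnegrE ?mulr_ge0 ?enorm_ge0//.
rewrite sqr_enorm; apply: (@le_trans _ _ (\sum_(i < d) `|u| ^+ 2)).
  apply: ler_sum => i _; rewrite -expr2 -real_normK ?num_real//.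
  by rewrite ler_pXn2r// ?nnegrE//; exact: coord_le_norm.
rewrite sumr_const card_ord -[leLHS]mulr_natl exprMn; apply: ler_wpM2r; first by rewrite exprn_ge0.
by rewrite -natrX ler_nat; case: d => // m; rewrite leq_pmulr.
Qed.

Lemma enorm_normalize u : u != 0 -> enorm ((enorm u)^-1 *: u) = 1.
Proof.
by move=> u0; rewrite enormZ ger0_norm ?invr_ge0 ?enorm_ge0// mulVf// enorm_eq0.
Qed.

Lemma bounded_set_enorm (Y : set 'rV[R]_d) : bounded_set Y ->
  exists2 r : R, 0 < r & forall y, Y y -> enorm y <= r.
Proof.
move=> [M [_ /(_ (`|M| + 1))]].
rewrite (le_lt_trans (ler_norm _)) ?ltrDl// => /(_ isT) YM.
exists (d%:R * (`|M| + 1) + 1) => [|y /YM /= yM].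
  by rewrite ltr_wpDl// mulr_ge0// addr_ge0.
apply: le_trans (enorm_le_norm _) _; rewrite ler_wpDr//.
by apply: ler_wpM2l.
Qed.

Lemma enorm_bounded_set (Y : set 'rV[R]_d) (r : R) :
  (forall y, Y y -> enorm y <= r) -> bounded_set Y.
Proof.
move=> Yr; exists r; split; first exact: num_real.
move=> M rM y /Yr yr; apply: row_norm_le.
  by rewrite (le_trans _ (ltW rM))// (le_trans _ yr)// enorm_ge0.
by move=> i; apply: le_trans (coord_le_enorm _ _) (le_trans yr (ltW rM)).
Qed.

Lemma elipschitz_continuous (f : 'rV[R]_d -> R) (L : R) :
  (forall u v, `|f u - f v| <= L * enorm (u - v)) -> continuous f.
Proof.
move=> fL u; suff h : f v @[v --> nbhs u] --> f u by exact: h.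
apply/cvgrPdist_lt => e e0.
pose M := `|L| * d%:R + 1.
have M0 : 0 < M by rewrite ltr_wpDl// mulr_ge0.
apply/nbhs_ballP; exists (e / M) => /=; first by rewrite divr_gt0.
move=> v; rewrite -ball_normE /= ltr_pdivlMr// => uv.
apply: le_lt_trans uv; apply: le_trans (fL _ _) _.
apply: (@le_trans _ _ (`|L| * enorm (u - v))).
  by apply: ler_wpM2r; [exact: enorm_ge0|exact: ler_norm].
apply: (@le_trans _ _ (`|L| * (d%:R * `|u - v|))).
  by apply: ler_wpM2l => //; exact: enorm_le_norm.
by rewrite mulrA [leRHS]mulrC; apply: ler_wpM2r => //; rewrite lerDl.
Qed.

Lemma enorm_continuous : continuous (@enorm R d).
Proof.
apply: (@elipschitz_continuous _ 1) => u v; rewrite mul1r ler_norml.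
have h1 := enormD_le (u - v) v; have h2 := enormD_le (v - u) u.
by rewrite subrK in h1; rewrite subrK enormBC in h2; lra.
Qed.

Lemma dotv_continuous v : continuous (fun u => dotv u v).
Proof.
apply: (@elipschitz_continuous _ (enorm v)) => u w; rewrite -dotvBl mulrC.
exact: cauchy_schwarz.
Qed.

Lemma esphere_closed : closed (esphere R d).
Proof.
have -> : esphere R d = @enorm R d @^-1` [set 1] by [].
by apply: closed_comp => [u _|]; [exact: enorm_continuous|exact: closed_eq].
Qed.

Lemma esphere_compact : compact (esphere R d).
Proof.
apply: bounded_closed_compact; last exact: esphere_closed.
by apply: (@enorm_bounded_set _ 1) => y /= ->.
Qed.

Definition reflection (e : 'rV[R]_d) : 'M[R]_d := 1%:M - 2 *: (e^T *m e).

Lemma mulmx_reflection u e : u *m reflection e = u - (2 * dotv u e) *: e.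
Proof.
rewrite /reflection mulmxBr mulmx1 -scalemxAr mulmxA [u *m e^T]mx11_scalar.
by rewrite mul_scalar_mx scalerA dotvE.
Qed.

Lemma tr_reflection e : (reflection e)^T = reflection e.
Proof.
by rewrite /reflection linearB /= trmx1 linearZ /= trmx_mul trmxK.
Qed.

Lemma reflectionK e : dotv e e = 1 -> reflection e *m reflection e = 1%:M.
Proof.
move=> e1; apply/row_matrixP => i; rewrite row_mul mulmx_reflection.
set r := row i (reflection e); have -> : r = row i 1%:M *m reflection e by rewrite -row_mul mul1mx.
set s := row i 1%:M; rewrite mulmx_reflection dotvBl dotvZl e1 mulr1.
rewrite -addrA -opprD -scalerDl.
have -> : 2 * dotv s e + 2 * (dotv s e - 2 * dotv s e) = 0 by ring.
by rewrite scale0r subr0.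
Qed.

Lemma reflection_orthogonal e : dotv e e = 1 -> reflection e *m (reflection e)^T = 1%:M.
Proof. by move=> e1; rewrite tr_reflection reflectionK. Qed.

(* Two block factorizations of [[1, e], [2 e^T, 1]] give the value 1 - 2 e e^T. *)
Lemma det_reflection e : dotv e e = 1 -> \det (reflection e) = -1.
Proof.
move=> e1.
pose M : 'M[R]_(1 + d) := block_mx 1%:M e (2 *: e^T) 1%:M.
have M1 : M = block_mx 1%:M 0 (2 *: e^T) 1%:M *m block_mx 1%:M e 0 (reflection e).
  rewrite mulmx_block !mul1mx !mul0mx !mulmx1 !addr0 /M.
  by rewrite -scalemxAl /reflection addrC subrK.
have M2 : M = block_mx (1%:M - 2 *: (e *m e^T)) e 0 1%:M *m block_mx 1%:M 0 (2 *: e^T) 1%:M.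
  rewrite mulmx_block !mul1mx !mul0mx !mulmx0 !mulmx1 !add0r /M.
  by rewrite -scalemxAr subrK.
have := congr1 determinant M1; rewrite {}M2 !det_mulmx !det_lblock !det_ublock !det1.
rewrite !mul1r !mulr1 => <-.
have -> : e *m e^T = 1%:M.
  by apply/matrixP => i j; rewrite !ord1 -dotvE e1 mxE eqxx.
by rewrite det_mx11 !mxE eqxx /= mulr1n; ring.
Qed.

Lemma enorm_mulmx u (Q : 'M[R]_d) : Q *m Q^T = 1%:M -> enorm (u *m Q) = enorm u.
Proof. by move=> QQ; rewrite /enorm dotv_mulmx -mulmxA QQ mulmx1. Qed.

(** The hyperplane bisecting [u] and [v] has normal [u - v]; for unit vectors the squared norm of
    [u - v] is twice the product of [u] with [u - v]. *)
Lemma exists_reflection u v : dotv u u = 1 -> dotv v v = 1 -> u != v ->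
  exists e, dotv e e = 1 /\ u *m reflection e = v.
Proof.
move=> u1 v1 uv.
have w0 : u - v != 0 by rewrite subr_eq0.
pose n := dotv (u - v) (u - v).
have nE : n = 2 - 2 * dotv u v.
  by rewrite /n !dotvBl !dotvBr u1 v1 (dotvC v u); ring.
have n0 : 0 < n by rewrite lt_neqAle eq_sym dotvv_eq0 w0 dotvv_ge0.
exists ((enorm (u - v))^-1 *: (u - v)); split; first by rewrite -esphereP /esphere /= enorm_normalize.
rewrite mulmx_reflection dotvZr scalerA.
have -> : 2 * ((enorm (u - v))^-1 * dotv u (u - v)) * (enorm (u - v))^-1 = 1.
  have -> : 2 * ((enorm (u - v))^-1 * dotv u (u - v)) * (enorm (u - v))^-1 =
     (2 * dotv u (u - v)) * ((enorm (u - v)) ^+ 2)^-1.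
    by rewrite -exprVn expr2; ring.
  rewrite sqr_enorm -/n dotvBr u1 mulrBr mulr1 -nE divff//.
  by rewrite gt_eqF.
by rewrite scale1r subKr.
Qed.

End Euclidean.

(** * Means over the sphere *)

Section BorelSpace.
Variables (R : realType) (d : nat).
Local Notation T := (borel_space R d).

Lemma open_borel (A : set 'rV[R]_d) : open A -> measurable (A : set T).
Proof. by move=> oA; apply: sub_sigma_algebra. Qed.

Lemma continuous_add (f g : 'rV[R]_d -> R) : continuous f -> continuous g ->
  continuous (fun u => f u + g u).
Proof. by move=> cf cg u; exact: (@continuousD _ R^o _ f g u (cf u) (cg u)). Qed.

Lemma continuous_sub (f g : 'rV[R]_d -> R) : continuous f -> continuous g ->
  continuous (fun u => f u - g u).
Proof. by move=> cf cg u; exact: (@continuousB _ R^o _ f g u (cf u) (cg u)). Qed.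

Lemma continuous_mul (f g : 'rV[R]_d -> R) : continuous f -> continuous g ->
  continuous (fun u => f u * g u).
Proof. by move=> cf cg u; exact: (@continuousM _ _ f g u (cf u) (cg u)). Qed.

Lemma continuous_cst (a : R) : continuous (fun _ : 'rV[R]_d => a).
Proof. by move=> u; exact: cst_continuous. Qed.

Lemma continuous_maxr (f : 'rV[R]_d -> R) (a : R) : continuous f ->
  continuous (fun u => Num.max (f u) a).
Proof.
move=> cf u.
apply: (@continuous_max R 'rV[R]_d f (fun=> a) u (cf u)).
exact: continuous_cst.
Qed.

Lemma closed_borel (A : set 'rV[R]_d) : closed A -> measurable (A : set T).
Proof.
move=> cA; rewrite -[A]setCK; apply: (@measurableC _ T); apply: open_borel.
exact: closed_openC.
Qed.

Lemma continuous_borel_fun (f : 'rV[R]_d -> R) : continuous f ->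
  measurable_fun setT (f : T -> R).
Proof.
move=> /continuousP cf; apply: (measurability _ (RGenOpens.measurableE R)).
move=> _ [_ [a [b ->] <-]]; rewrite setTI.
by apply: open_borel; apply: cf; exact: interval_open.
Qed.

Lemma esphere_borel : measurable (esphere R d : set T).
Proof. by apply: closed_borel; exact: esphere_closed. Qed.

Lemma norm_le_enorm (u : 'rV[R]_d) : `|u| <= enorm u.
Proof. by apply: row_norm_le; [exact: enorm_ge0|move=> i; exact: coord_le_enorm]. Qed.

Lemma continuous_orthogonal (Q : 'M[R]_d) : Q *m Q^T = 1%:M ->
  continuous (fun u : 'rV[R]_d => u *m Q).
Proof.
move=> QQ u; suff h : (v *m Q) @[v --> nbhs u] --> u *m Q by exact: h.
apply/cvgrPdist_lt => e e0; apply/nbhs_ballP; exists (e / (d%:R + 1)) => /=.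
  by rewrite divr_gt0// ltr_wpDl.
move=> v; rewrite -ball_normE /= ltr_pdivlMr ?ltr_wpDl// => uv.
apply: le_lt_trans uv; rewrite -mulmxBl (le_trans (norm_le_enorm _))// enorm_mulmx//.
apply: le_trans (enorm_le_norm _) _; rewrite mulrC; apply: ler_wpM2l => //.
by rewrite lerDl.
Qed.

Lemma continuous_comp_orthogonal (Q : 'M[R]_d) (f : 'rV[R]_d -> R) :
  Q *m Q^T = 1%:M -> continuous f -> continuous (fun u : 'rV[R]_d => f (u *m Q)).
Proof.
move=> QQ cf u; apply: (@continuous_comp 'rV[R]_d 'rV[R]_d R (fun u => u *m Q) f); last exact: cf.
exact: continuous_orthogonal.
Qed.

End BorelSpace.

Section SphereMean.
Variables (R : realType) (d : nat).
Variable sigma : probability (borel_space R d) R.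
Hypothesis sigma_sphere : rotation_invariant_sphere_probability sigma.
Implicit Types (f g : 'rV[R]_d -> R) (u v w : 'rV[R]_d) (Q : 'M[R]_d).
Local Notation S := (esphere R d).
Local Notation T := (borel_space R d).

Definition sphere_mean f : R := \int[sigma]_(u in (S : set T)) f u.

Lemma continuous_esphere_bounded f : continuous f ->
  exists2 C : R, 0 < C & forall u, S u -> `|f u| <= C.
Proof.
move=> cf.
have : compact (f @` S).
  by apply: continuous_compact; [exact: continuous_subspaceT|exact: esphere_compact].
move=> /compact_bounded[C [_ /(_ (`|C| + 1))]].
rewrite (le_lt_trans (ler_norm _)) ?ltrDl// => /(_ isT) H.
by exists (`|C| + 1) => [|u Su]; [rewrite ltr_wpDl|apply: H; exists u].
Qed.

Lemma sphere_integrable f : continuous f -> sigma.-integrable (S : set T) (EFin \o f).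
Proof.
move=> cf; apply: measurable_bounded_integrable.
- exact: esphere_borel.
- by rewrite (le_lt_trans (probability_le1 _ _)) ?ltey//; exact: esphere_borel.
- by apply: measurable_funTS; exact: continuous_borel_fun.
- have [C _ HC] := continuous_esphere_bounded cf; exists C; split; first exact: num_real.
  by move=> M CM u Su; apply: le_trans (HC u Su) (ltW CM).
Qed.

Lemma sphere_meanD f g : continuous f -> continuous g ->
  sphere_mean (fun u => f u + g u) = sphere_mean f + sphere_mean g.
Proof.
by move=> cf cg; apply: RintegralD; [exact: esphere_borel|exact: sphere_integrable..].
Qed.

Lemma sphere_meanB f g : continuous f -> continuous g ->
  sphere_mean (fun u => f u - g u) = sphere_mean f - sphere_mean g.
Proof.
by move=> cf cg; apply: RintegralB; [exact: esphere_borel|exact: sphere_integrable..].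
Qed.

Lemma sphere_meanZ f (a : R) : continuous f ->
  sphere_mean (fun u => a * f u) = a * sphere_mean f.
Proof.
by move=> cf; apply: RintegralZl; [exact: esphere_borel|exact: sphere_integrable].
Qed.

Lemma sphere_mean_cst (a : R) : sphere_mean (fun=> a) = a.
Proof.
rewrite /sphere_mean Rintegral_cst; last exact: esphere_borel.
by rewrite -[RHS]mulr1; congr (_ * _); exact: (congr1 fine (proj1 sigma_sphere)).
Qed.

Lemma sphere_mean_le f g : continuous f -> continuous g ->
  (forall u, S u -> f u <= g u) -> sphere_mean f <= sphere_mean g.
Proof.
by move=> cf cg fg; apply: le_Rintegral => //; [exact: esphere_borel|exact: sphere_integrable..].
Qed.

Lemma eq_sphere_mean f g : (forall u, S u -> f u = g u) -> sphere_mean f = sphere_mean g.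
Proof. by move=> fg; apply: eq_Rintegral => u; rewrite inE => /fg. Qed.

Lemma sphere_mean_EFin f : continuous f ->
  (sphere_mean f)%:E = (\int[sigma]_(u in (S : set T)) (f u)%:E)%E.
Proof.
move=> cf; rewrite /sphere_mean /Rintegral fineK//.
by apply: integrable_fin_num; [exact: esphere_borel|exact: sphere_integrable].
Qed.

(* It suffices to test nonnegative functions: add a constant and truncate. *)
Lemma sphere_mean_comp_eq (P : ('rV[R]_d -> R) -> Prop) (phi : 'rV[R]_d -> 'rV[R]_d) :
  (forall u, S u -> S (phi u)) -> continuous phi -> (forall f, P f -> continuous f) ->
  (forall f (C : R), P f -> P (fun u => Num.max (f u + C) 0)) ->
  (forall f, P f -> (forall u, 0 <= f u) -> sphere_mean (f \o phi) = sphere_mean f) ->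
  forall f, P f -> sphere_mean (f \o phi) = sphere_mean f.
Proof.
move=> Sphi cphi Pc Pmax H f Pf; have cf := Pc f Pf.
have cc (g : 'rV[R]_d -> R) : continuous g -> continuous (g \o phi).
  by move=> cg u; apply: continuous_comp; [exact: cphi|exact: cg].
have [C C0 HC] := continuous_esphere_bounded cf.
pose g u := Num.max (f u + C) 0.
have gE u : S u -> g u = f u + C.
  by move=> /HC; rewrite ler_norml => /andP[h _]; rewrite /g max_l//; lra.
have g0 u : 0 <= g u by rewrite /g le_max lexx orbT.
have := H g (Pmax f C Pf) g0.
rewrite (@eq_sphere_mean (g \o phi) (fun u => (f \o phi) u + C)); last first.
  by move=> u Su /=; rewrite gE//; exact: Sphi.
rewrite (@eq_sphere_mean g (fun u => f u + C))//.
rewrite !sphere_meanD//; try exact: continuous_cst; last exact: cc.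
by move/addIr.
Qed.

Lemma sphere_mean_rotation f Q : Q *m Q^T = 1%:M -> \det Q = 1 -> continuous f ->
  sphere_mean (fun u => f (u *m Q)) = sphere_mean f.
Proof.
move=> QQ detQ; move: f.
apply: sphere_mean_comp_eq => [u Su|||f C cf|f cf f0].
- by rewrite /esphere /= enorm_mulmx.
- exact: continuous_orthogonal.
- by [].
- by apply: continuous_maxr; apply: continuous_add => //; exact: continuous_cst.
apply: EFin_inj; rewrite !sphere_mean_EFin//; last exact: continuous_comp_orthogonal.
pose phi : T -> T := fun u => (u : 'rV[R]_d) *m Q.
have mphi : measurable_fun setT phi.
  apply: (@measurability _ _ T T setT phi (@open 'rV[R]_d)) => //.
  move=> _ [A oA <-]; rewrite setTI.
  by apply: open_borel; move/continuousP: (continuous_orthogonal QQ); exact.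
have SE : (phi @^-1` (S : set T)) = (S : set T).
  by apply/seteqP; split=> u; rewrite /phi /esphere /= enorm_mulmx.
have := @ge0_integral_pushforward _ _ T T R phi mphi sigma (S : set T) (fun u => (f u)%:E).
rewrite SE => <-.
- apply: eq_measure_integral => A mA _.
  exact: (proj2 sigma_sphere Q QQ detQ A mA).
- exact: esphere_borel.
- by apply/measurable_EFinP; apply: measurable_funTS; exact: continuous_borel_fun.
- by move=> u _; rewrite lee_fin.
Qed.

End SphereMean.

(** * Spherical caps and invariance under all orthogonal matrices *)

Section CapFunctions.
Variables (R : realType) (d : nat).
Variable sigma : probability (borel_space R d) R.
Hypothesis sigma_sphere : rotation_invariant_sphere_probability sigma.
Hypothesis d_even : ~~ odd d.
Implicit Types (f g : 'rV[R]_d -> R) (u v w : 'rV[R]_d) (Q : 'M[R]_d) (t : R).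
Local Notation S := (esphere R d).
Local Notation T := (borel_space R d).
Local Notation mean := (sphere_mean sigma).

Lemma sphere_mean_sum (I : Type) (s : seq I) (F : I -> 'rV[R]_d -> R) :
  (forall i, continuous (F i)) ->
  continuous (fun u => \sum_(i <- s) F i u) /\
  mean (fun u => \sum_(i <- s) F i u) = \sum_(i <- s) mean (F i).
Proof.
move=> cF; elim: s => [|i s [IHc IHm]].
  have -> : (fun u => \sum_(i <- [::]) F i u) = (fun=> 0).
    by apply/funext => u; rewrite big_nil.
  by rewrite big_nil; split; [exact: continuous_cst|exact: sphere_mean_cst].
have -> : (fun u => \sum_(i <- i :: s) F i u) = (fun u => F i u + \sum_(i <- s) F i u).
  by apply/funext => u; rewrite big_cons.
rewrite big_cons -IHm; split; first exact: continuous_add.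
exact: sphere_meanD.
Qed.

(** A continuous substitute for the indicator of the cap around [u]. Its symmetry in [u] and [v]
    allows integration in either variable. *)
Definition cap_fun t u v : R := Num.max (dotv u v - t) 0.

Lemma cap_fun_ge0 t u v : 0 <= cap_fun t u v.
Proof. by rewrite le_max lexx orbT. Qed.

Lemma cap_funC t u v : cap_fun t u v = cap_fun t v u.
Proof. by rewrite /cap_fun dotvC. Qed.

Lemma cap_fun_mulmx t u v Q : cap_fun t (u *m Q) v = cap_fun t u (v *m Q^T).
Proof. by rewrite /cap_fun dotv_mulmx. Qed.

Lemma cap_fun_continuous t u : continuous (cap_fun t u).
Proof.
apply: continuous_maxr; apply: continuous_sub; last exact: continuous_cst.
have -> : dotv u = fun v => dotv v u by apply/funext => v; rewrite dotvC.
exact: dotv_continuous.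
Qed.

Definition cap_mass t u := mean (cap_fun t u).

Lemma trmx_orthogonal Q : Q *m Q^T = 1%:M -> Q^T *m Q^T^T = 1%:M.
Proof. by rewrite trmxK => /mulmx1C. Qed.

Lemma cap_mass_rotation t u Q : Q *m Q^T = 1%:M -> \det Q = 1 ->
  cap_mass t (u *m Q) = cap_mass t u.
Proof.
move=> QQ detQ; rewrite /cap_mass.
rewrite -[RHS](sphere_mean_rotation sigma_sphere (trmx_orthogonal QQ)).
- by apply: eq_sphere_mean => v _; exact: cap_fun_mulmx.
- by rewrite det_tr.
- exact: cap_fun_continuous.
Qed.

Lemma opp_orthogonal : (- 1%:M : 'M[R]_d) *m (- 1%:M)^T = 1%:M.
Proof. by rewrite linearN /= trmx1 mulNmx mulmxN opprK mulmx1. Qed.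

(** Two reflections, one sending [u] to [- w] and one sending [- w] to [w], compose to determinant
    1. If [u] is [- w], the matrix -1 serves, a rotation since the dimension is even. *)
Lemma cap_mass_eq t u w : S u -> S w -> cap_mass t u = cap_mass t w.
Proof.
move=> Su Sw; have w1 : dotv w w = 1 by apply/esphereP.
have u1 : dotv u u = 1 by apply/esphereP.
have nw1 : dotv (- w) (- w) = 1 by rewrite dotvNl dotvNr opprK.
have [->|uw] := eqVneq u (- w).
  rewrite -[RHS](@cap_mass_rotation _ _ (- 1%:M)).
  - by rewrite mulmxN mulmx1.
  - exact: opp_orthogonal.
  - by rewrite -scaleN1r detZ det1 mulr1 -signr_odd (negbTE d_even).
have [e [e1 ue]] := exists_reflection u1 nw1 uw.
rewrite -(@cap_mass_rotation _ _ (reflection e *m reflection w)).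
- rewrite mulmxA ue mulmx_reflection dotvNl w1; congr (cap_mass _ _).
  by rewrite mulrN1 scaleNr opprK scaler_nat mulr2n addrA addNr add0r.
- rewrite trmx_mul !tr_reflection mulmxA -(mulmxA (reflection e)) reflectionK//.
  by rewrite mulmx1 reflectionK.
- by rewrite det_mulmx !det_reflection// mulrNN mulr1.
Qed.

(** Finitely many caps cover the sphere, so the sum of their functions has a positive minimum and a
    positive mean; its terms all have the same mean. *)
Lemma cap_mass_gt0 t u : t < 1 -> S u -> 0 < cap_mass t u.
Proof.
move=> t1 Su; have : cover_compact S by rewrite -compact_cover; exact: esphere_compact.
move=> /(_ _ S (fun w => [set v | t < dotv w v])) [w _||D DS SD].
- have -> : [set v | t < dotv w v] = (fun v => dotv v w) @^-1` [set x | t < x].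
    by apply/seteqP; split => v /=; rewrite dotvC.
  apply: open_comp => [v _|]; first exact: dotv_continuous.
  exact: open_gt.
- by move=> v Sv; exists v => //=; move/esphereP: Sv => ->.
have [cG mG] := @sphere_mean_sum _ (finmap.enum_fset D) (cap_fun t) (fun w => @cap_fun_continuous t w).
set G := fun v => _ in cG mG.
have S0 : S !=set0 by exists u.
have [c /set_mem Sc Hc] := EVT_min_rV S0 (@esphere_compact R d) (continuous_subspaceT cG).
have Gc : 0 < G c.
  have [w /= wD tw] := SD c Sc.
  rewrite /G (big_rem w)//=; apply: ltr_pwDl; first by rewrite lt_max subr_gt0 tw.
  by apply: sumr_ge0 => i _; exact: cap_fun_ge0.
have : G c <= mean G.
  rewrite -(sphere_mean_cst sigma_sphere (G c)); apply: sphere_mean_le => //.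
    exact: continuous_cst.
  by move=> v Sv; apply: Hc; exact/mem_set.
rewrite mG => /(lt_le_trans Gc).
rewrite big_seq (eq_bigr (fun=> cap_mass t u)); last first.
  by move=> w wD; apply: cap_mass_eq => //; apply/set_mem/DS.
rewrite -big_seq big_const_seq count_predT iter_addr_0.
by case: (size _) => [|n]; [rewrite mulr0n ltxx|rewrite pmulrn_lgt0].
Qed.

Lemma cap_fun_le t u v : S u -> S v -> t <= 1 -> cap_fun t u v <= 1 - t.
Proof.
move=> Su Sv t1; rewrite ge_max subr_ge0 t1 andbT lerB//.
by apply: le_trans (dotv_le _ _) _; rewrite Su Sv mulr1.
Qed.

(** On the cap, [g u - e] bounds [g] from below; averaging against the cap function, which is at
    most [1 - t], turns a large value at one point into a large mean. *)
Lemma sphere_mean_pointwise g t (e : R) u : continuous g -> (forall v, S v -> 0 <= g v) ->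
  t < 1 -> S u -> (forall v, S v -> t < dotv u v -> g u <= g v + e) ->
  cap_mass t u * (g u - e) <= (1 - t) * mean g.
Proof.
move=> cg g0 t1 Su ge; rewrite mulrC -!sphere_meanZ//; last exact: cap_fun_continuous.
apply: sphere_mean_le.
- by apply: continuous_mul; [exact: continuous_cst|exact: cap_fun_continuous].
- by apply: continuous_mul => //; exact: continuous_cst.
move=> v Sv; have c0 := cap_fun_ge0 t u v.
have gv := g0 v Sv; have c1 := cap_fun_le Su Sv (ltW t1).
have [vt|tv] := leP (dotv u v) t.
  have -> : cap_fun t u v = 0 by apply/max_idPr; rewrite subr_le0.
  by rewrite mulr0 mulr_ge0// subr_ge0 ltW.
have := ge v Sv tv; nra.
Qed.

Lemma close_on_sphere (s : R) : 0 < s -> exists2 t, t < 1 &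
  forall u v, S u -> S v -> t < dotv u v -> enorm (u - v) <= s.
Proof.
move=> s0; exists (1 - s ^+ 2 / 2); first by rewrite ltrBlDr ltrDl divr_gt0// exprn_gt0.
move=> u v /esphereP u1 /esphereP v1 uv.
rewrite -(@ler_pXn2r _ 2)// ?nnegrE ?enorm_ge0 ?(ltW s0)// sqr_enorm.
by rewrite dotvBl !dotvBr u1 v1 (dotvC v u); lra.
Qed.

Definition elipschitz (L : R) f := forall u v, `|f u - f v| <= L * enorm (u - v).

(** The complement of the sphere is negligible; this connects Fubini on the whole space with means
    over the sphere. *)
Lemma sphere_full (g : T -> \bar R) : measurable_fun setT g -> (forall u, 0 <= g u)%E ->
  (\int[sigma]_(u in (S : set T)) g u = \int[sigma]_u g u)%E.
Proof.
move=> mg g0; have mS : measurable (S : set T) by exact: esphere_borel.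
rewrite [RHS](@ge0_negligible_integral _ _ _ _ setT (~` (S : set T)))//.
- by rewrite setTD setCK.
- exact: measurableC.
- apply: etrans (probability_setC sigma mS) _.
  by rewrite [X in (_ - X)%E](proj1 sigma_sphere) subee.
Qed.

(* Both iterated integrals of f v * cap_fun t (u *m Q) v over the sphere: the
   cap function localizes v near u *m Q. *)
Lemma sphere_mean_orthogonal_le f (L : R) t (s : R) Q : Q *m Q^T = 1%:M ->
  elipschitz L f -> 0 <= L -> (forall u, 0 <= f u) -> t < 1 ->
  (forall u v, S u -> S v -> t < dotv u v -> enorm (u - v) <= s) ->
  mean f <= mean (fun u => f (u *m Q)) + L * s.
Proof.
move=> QQ fL L0 f0 t1 ts.
have cf : continuous f by exact: elipschitz_continuous fL.
have cfQ : continuous (fun u : 'rV[R]_d => f (u *m Q)) by exact: continuous_comp_orthogonal.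
have [/set0P[u0 Su0]|S0] := pselect (S != set0); last first.
  exfalso; apply: S0; apply/set0P; apply: contrapT => S0.
  have := proj1 sigma_sphere; have -> : (S : set T) = set0.
    by apply/seteqP; split => // u Su; case: S0; exists u.
  by rewrite measure0 => /eqP; rewrite eqe eq_sym oner_eq0.
pose c := cap_mass t u0.
have c0 : 0 < c by exact: cap_mass_gt0.
pose F (p : T * T) : \bar R := (f p.2 * cap_fun t ((p.1 : 'rV[R]_d) *m Q) p.2)%:E.
have F0 p : (0 <= F p)%E by rewrite lee_fin mulr_ge0// cap_fun_ge0.
have mF : measurable_fun setT F.
  apply/measurable_EFinP; apply: measurable_funM.
    by apply: (measurableT_comp (continuous_borel_fun cf)).
  apply: measurable_maxr => //; apply: measurable_funB => //.
  apply: measurable_sum => i; apply: measurable_funM.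
    have ci : continuous (fun u : 'rV[R]_d => (u *m Q) ord0 i).
      apply: (@continuous_comp_orthogonal _ _ _ (fun u => u ord0 i)) => //.
      exact: coord_continuous.
    exact: (measurableT_comp (continuous_borel_fun ci)).
  exact: (measurableT_comp (continuous_borel_fun (@coord_continuous _ _ _ ord0 i))).
have capc Q' u : continuous (fun v => f v * cap_fun t (u *m Q') v).
  by apply: continuous_mul => //; exact: cap_fun_continuous.
have capc' v : continuous (fun u : 'rV[R]_d => f v * cap_fun t (u *m Q) v).
  apply: continuous_mul; first exact: continuous_cst.
  apply: (@continuous_comp_orthogonal _ _ _ (fun u => cap_fun t u v)) => //.
  have -> : (cap_fun t)^~ v = cap_fun t v by apply/funext => u; rewrite cap_funC.
  exact: cap_fun_continuous.
have F1 u : (\int[sigma]_v F (u, v) = (mean (fun v => f v * cap_fun t ((u : 'rV[R]_d) *m Q) v))%:E)%E.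
  rewrite sphere_mean_EFin//.
  rewrite (@sphere_full (fun v => F (u, v)))//.
  by apply: (measurableT_comp mF); exact: pair1_measurable.
have F2 v : (\int[sigma]_u F (u, v) = (mean (fun u => f v * cap_fun t (u *m Q) v))%:E)%E.
  rewrite sphere_mean_EFin//.
  rewrite (@sphere_full (fun u => F (u, v)))//.
  by apply: (measurableT_comp mF); exact: pair2_measurable.
have := @fubini_tonelli _ _ T T R sigma sigma F mF F0.
rewrite -[RHS]sphere_full; last 2 first.
- exact: measurable_fun_fubini_tonelli_G.
- by move=> v; apply: integral_ge0.
rewrite -[LHS]sphere_full; last 2 first.
- exact: measurable_fun_fubini_tonelli_F.
- by move=> v; apply: integral_ge0.
(* With [u] integrated first, [Q] moves to the other side and the inner factor becomes the mass of a
   cap centred at [v *m Q^T], which is [c] for every [v]. *)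
have -> : (\int[sigma]_(v in (S : set T)) \int[sigma]_u F (u, v) = (c * mean f)%:E)%E.
  rewrite -sphere_meanZ// sphere_mean_EFin; last first.
    by apply: continuous_mul => //; exact: continuous_cst.
  apply: eq_integral => v /set_mem Sv; rewrite F2; congr EFin.
  rewrite sphere_meanZ; last first.
    apply: (@continuous_comp_orthogonal _ _ _ (fun u => cap_fun t u v)) => //.
    have -> : (cap_fun t)^~ v = cap_fun t v by apply/funext => u; rewrite cap_funC.
    exact: cap_fun_continuous.
  rewrite mulrC; congr (_ * _).
  rewrite (@eq_sphere_mean _ _ _ _ (cap_fun t ((v : 'rV[R]_d) *m Q^T))); last first.
    by move=> u _; rewrite cap_fun_mulmx cap_funC.
  apply: cap_mass_eq => //; rewrite /esphere /= enorm_mulmx//.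
  exact: trmx_orthogonal.
move=> FE.
have : ((c * mean f)%:E <= (c * (mean (fun u => f (u *m Q)) + L * s))%:E)%E.
  rewrite -FE.
  have -> : c * (mean (fun u => f (u *m Q)) + L * s) = mean (fun u => c * (f (u *m Q) + L * s)).
    rewrite sphere_meanZ; last by apply: continuous_add => //; exact: continuous_cst.
    rewrite sphere_meanD//; last exact: continuous_cst.
    by rewrite (sphere_mean_cst sigma_sphere).
  have cg : continuous (fun u : 'rV[R]_d => c * (f (u *m Q) + L * s)).
    apply: continuous_mul; first exact: continuous_cst.
    by apply: continuous_add => //; exact: continuous_cst.
  rewrite (sphere_mean_EFin sigma cg); apply: ge0_le_integral.
  - exact: esphere_borel.
  - by move=> u _; apply: integral_ge0.
  - by apply: measurable_funTS; exact: measurable_fun_fubini_tonelli_F.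
  - by apply/measurable_EFinP; apply: measurable_funTS; exact: continuous_borel_fun.
  move=> u Su; rewrite F1 lee_fin.
  have SuQ : S ((u : 'rV[R]_d) *m Q) by rewrite /esphere /= enorm_mulmx.
  have -> : c = cap_mass t ((u : 'rV[R]_d) *m Q) by exact: cap_mass_eq.
  rewrite mulrC -sphere_meanZ; last exact: cap_fun_continuous.
  apply: sphere_mean_le => //.
    by apply: continuous_mul; [exact: continuous_cst|exact: cap_fun_continuous].
  move=> v Sv; have [vt|tv] := leP (dotv ((u : 'rV[R]_d) *m Q) v) t.
    have -> : cap_fun t ((u : 'rV[R]_d) *m Q) v = 0 by apply/max_idPr; rewrite subr_le0.
    by rewrite !mulr0.
  apply: ler_wpM2r; first exact: cap_fun_ge0.
  have h := fL v (u *m Q); have := ler_wpM2l L0 (ts _ _ SuQ Sv tv).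
  by move: h; rewrite enormBC ler_norml => /andP[_]; lra.
by rewrite lee_fin ler_pM2l.
Qed.

(** Letting [s] tend to 0 gives one inequality, and the transpose of [Q] the other. This brings in
    determinant -1, and so the reflections of Steiner symmetrization. *)
Lemma sphere_mean_orthogonal f (L : R) Q : Q *m Q^T = 1%:M -> elipschitz L f ->
  mean (fun u => f (u *m Q)) = mean f.
Proof.
move=> QQ fL.
pose P g := exists2 L : R, 0 <= L & elipschitz L g.
have Pf : P f.
  exists `|L| => // u v; apply: le_trans (fL u v) _.
  by apply: ler_wpM2r; [exact: enorm_ge0|exact: ler_norm].
have le g Q' : Q' *m Q'^T = 1%:M -> P g -> (forall u, 0 <= g u) ->
    mean g <= mean (fun u => g (u *m Q')).
  move=> QQ' [M M0 gM] g0; apply/ler_addgt0Pr => e e0.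
  have [t t1 ts] := @close_on_sphere (e / (M + 1)) (divr_gt0 e0 (ltr_wpDl M0 ltr01)).
  apply: le_trans (sphere_mean_orthogonal_le QQ' gM M0 g0 t1 ts) _.
  rewrite lerD2l mulrCA ger_pMr// ler_pdivrMr ?ltr_wpDl// mul1r.
  by rewrite lerDl.
move: f Pf {fL}; apply: sphere_mean_comp_eq => [u Su||g [M _ gM]|g C [M M0 gM]|g Pg g0].
- by rewrite /esphere /= enorm_mulmx.
- exact: continuous_orthogonal.
- exact: elipschitz_continuous gM.
- exists M => // u v; apply: le_trans (gM u v).
  have h1 := ler_norm (g u - g v); have h2 := ler_norm (g v - g u).
  rewrite distrC in h2; rewrite ler_norml.
  by case: (leP (g u + C) 0) => h3; case: (leP (g v + C) 0) => h4; apply/andP; split; lra.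
- apply/eqP; rewrite eq_le [X in _ && X]le// andbT.
  have PQ : P (fun u => g (u *m Q)).
    have [M M0 gM] := Pg; exists M => // u v.
    by apply: le_trans (gM _ _) _; rewrite -mulmxBl enorm_mulmx.
  apply: le_trans (le _ _ (trmx_orthogonal QQ) PQ _) _ => //.
  rewrite (@eq_sphere_mean _ _ _ _ g)// => u _ /=.
  by rewrite -mulmxA (mulmx1C QQ) mulmx1.
Qed.

End CapFunctions.

(** * Support functions and near-minimizers of the mean width *)

Lemma row_ext (T : Type) (d : nat) (u v : 'rV[T]_d) :
  (forall i, u ord0 i = v ord0 i) -> u = v.
Proof. by move=> uv; apply/rowP => i; exact: uv. Qed.

Section SupportFunction.
Variables (R : realType) (d : nat).
Implicit Types (Y : set 'rV[R]_d) (u v w x y a : 'rV[R]_d).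
Local Notation h := support_function.

Variables (Y : set 'rV[R]_d) (r : R).
Hypotheses (Y0 : Y !=set0) (Yr : forall y, Y y -> enorm y <= r).

Let has_sup_dotv u : has_sup [set dotv k u | k in Y].
Proof.
have [y Yy] := Y0; split; first by exists (dotv y u), y.
exists (r * enorm u) => _ [k /Yr kr <-]; apply: le_trans (dotv_le _ _) _.
by apply: ler_wpM2r => //; exact: enorm_ge0.
Qed.

Lemma dotv_le_support y u : Y y -> dotv y u <= h Y u.
Proof. by move=> Yy; apply: ub_le_sup; [case: (has_sup_dotv u)|exists y]. Qed.

Lemma support_le u (c : R) : (forall y, Y y -> dotv y u <= c) -> h Y u <= c.
Proof.
move=> H; apply: ge_sup; first by case: (has_sup_dotv u).
by move=> _ [y Yy <-]; exact: H.
Qed.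

Lemma support_adherent u (e : R) : 0 < e -> exists2 y, Y y & h Y u - e < dotv y u.
Proof.
by move=> e0; have [_ [y Yy <-] H] := sup_adherent e0 (has_sup_dotv u); exists y.
Qed.

Lemma support_elipschitz : elipschitz r (h Y).
Proof.
have main u v : h Y u <= h Y v + r * enorm (u - v).
  apply: support_le => y Yy; have -> : dotv y u = dotv y v + dotv y (u - v).
    by rewrite dotvBr addrC subrK.
  apply: lerD; first exact: dotv_le_support.
  apply: le_trans (dotv_le _ _) _; apply: ler_wpM2r; [exact: enorm_ge0|exact: Yr].
move=> u v; rewrite ler_norml; have := main u v; have := main v u.
by rewrite (enormBC v u); lra.
Qed.

Lemma support_continuous : continuous (h Y).
Proof. exact: elipschitz_continuous support_elipschitz. Qed.

Lemma supportZ (a : R) u : 0 <= a -> h Y (a *: u) = a * h Y u.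
Proof.
rewrite le_eqVlt => /predU1P[<-|a0].
  rewrite scale0r mul0r; apply/eqP; rewrite eq_le; apply/andP; split.
    by apply: support_le => y _; rewrite dotvC dot0v.
  by have [y Yy] := Y0; rewrite (le_trans _ (dotv_le_support _ Yy))// dotvC dot0v.
apply/eqP; rewrite eq_le; apply/andP; split.
  apply: support_le => y Yy; rewrite dotvZr ler_pM2l//; exact: dotv_le_support.
rewrite -ler_pdivlMl//; apply: support_le => y Yy.
rewrite ler_pdivlMl// -dotvZr; exact: dotv_le_support.
Qed.

Lemma support_translate a u : h ((fun y => y + a) @` Y) u = h Y u + dotv a u.
Proof.
rewrite /h /support_function; have [h1 h2] := has_sup_dotv u.
apply/eqP; rewrite eq_le; apply/andP; split.
  apply: ge_sup.
    by have [y Yy] := Y0; exists (dotv (y + a) u), (y + a) => //; exists y.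
  move=> _ [_ [y Yy <-] <-]; rewrite dotvDl lerD2r; exact: dotv_le_support.
rewrite -lerBrDr; apply: ge_sup => // _ [y Yy <-].
rewrite lerBrDr -dotvDl; apply: ub_le_sup; last by exists (y + a) => //; exists y.
exists (h Y u + dotv a u) => _ [_ [z Yz <-] <-].
by rewrite dotvDl lerD2r; exact: dotv_le_support.
Qed.

Lemma support_mulmx Q u : h ((fun y => y *m Q) @` Y) u = h Y (u *m Q^T).
Proof.
rewrite /h /support_function; congr sup; apply/seteqP; split.
  by move=> _ [_ [y Yy <-] <-]; exists y => //; rewrite dotv_mulmx.
by move=> _ [y Yy <-]; exists (y *m Q); [exists y|rewrite dotv_mulmx].
Qed.

(** The closed convex hull of [Y], as an intersection of half-spaces, from which closedness and
    convexity are read off. Passing to it loses no volume, and its points obey the bounds given by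
    the support function of [Y]. *)
Definition wulff : set 'rV[R]_d := [set x | forall u, dotv x u <= h Y u].

Lemma sub_wulff : Y `<=` wulff.
Proof. by move=> y Yy u; exact: dotv_le_support. Qed.

(** The defining inequality is tested in the direction [x] itself. *)
Lemma wulff_enorm x : 0 <= r -> wulff x -> enorm x <= r.
Proof.
move=> r0 /(_ x); rewrite -sqr_enorm => xx.
have : h Y x <= r * enorm x.
  apply: support_le => y Yy; apply: le_trans (dotv_le _ _) _.
  by apply: ler_wpM2r; [exact: enorm_ge0|exact: Yr].
move=> /(le_trans xx); have := enorm_ge0 x; rewrite le_eqVlt => /predU1P[<-//|x0].
by rewrite expr2 ler_pM2r.
Qed.

Lemma wulff_closed : closed wulff.
Proof.
have -> : wulff = \bigcap_(u in setT) ((fun x => dotv x u) @^-1` [set t | t <= h Y u]).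
  by apply/seteqP; split=> [x xK u _|x xK u]; [exact: xK|exact: (xK u I)].
apply: closed_bigI => u _; apply: closed_comp => [x _|]; first exact: dotv_continuous.
exact: closed_le.
Qed.

Lemma wulff_compact : 0 <= r -> compact wulff.
Proof.
move=> r0; apply: bounded_closed_compact; last exact: wulff_closed.
by apply: (@enorm_bounded_set _ _ _ r) => y; exact: wulff_enorm.
Qed.

Lemma wulff_vertically_convex (i0 : 'I_d) y (s q t : R) :
  wulff (upd y i0 s) -> wulff (upd y i0 t) -> s <= q <= t -> wulff (upd y i0 q).
Proof.
move=> ys yt /andP[sq qt] u; have := ys u; have := yt u.
have E c : dotv (upd y i0 c) u = c * u ord0 i0 + \sum_(i | i != i0) y ord0 i * u ord0 i.
  rewrite /dotv (bigD1 i0)//= mxE eqxx; congr (_ + _).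
  by apply: eq_bigr => i /negbTE ii0; rewrite mxE ii0.
rewrite !E; set c := \sum_(i | _) _; have [u0|u0] := leP 0 (u ord0 i0).
  by have := ler_wpM2r u0 qt; lra.
by have := ler_wnM2r (ltW u0) sq; lra.
Qed.

End SupportFunction.

(** * Stability of near-minimizers *)

Section Stability.
Variables (R : realType) (d : nat).
Variable sigma : probability (borel_space R d) R.
Hypothesis sigma_sphere : rotation_invariant_sphere_probability sigma.
Hypothesis d_even : ~~ odd d.
Hypothesis d_gt0 : (0 < d)%N.
Implicit Types (Y : set 'rV[R]_d) (u v w x y a : 'rV[R]_d).
Local Notation h := support_function.
Local Notation S := (esphere R d).
Local Notation mean := (sphere_mean sigma).
Local Notation mu := (@lebesgue_outer R d).

Let i0 : 'I_d := Ordinal d_gt0.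
Let e0 : 'rV[R]_d := delta_mx ord0 i0.

Let e01 : dotv e0 e0 = 1.
Proof. by rewrite dotv_delta mxE !eqxx. Qed.

(** A Lipschitz function that is large at a point stays large on a cap of fixed size, which
    contributes a fixed amount to the mean. That [eta] is chosen before [g] makes the later
    estimates uniform over all sets in a ball. *)
Lemma sphere_mean_small (L e : R) : 0 <= L -> 0 < e -> exists2 eta : R, 0 < eta &
  forall g, elipschitz L g -> (forall u, S u -> 0 <= g u) -> mean g <= eta ->
  forall u, S u -> g u <= e.
Proof.
move=> L0 ep.
have [t t1 ts] := @close_on_sphere R d (e / 2 / (L + 1))
  (divr_gt0 (divr_gt0 ep (ltr0Sn _ 1)) (ltr_wpDl L0 ltr01)).
have Se0 : S e0 by apply/esphereP.
have c0 := cap_mass_gt0 sigma_sphere d_even t1 Se0.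
exists (cap_mass sigma t e0 * (e / 2) / (1 - t)).
  by rewrite divr_gt0 ?mulr_gt0 ?divr_gt0 ?subr_gt0.
move=> g gL g0 mg u Su.
have cg : continuous g := elipschitz_continuous gL.
have := @sphere_mean_pointwise R d sigma g t (e / 2) u cg g0 t1 Su.
rewrite (cap_mass_eq sigma_sphere d_even t Su Se0) => H.
have {}H : cap_mass sigma t e0 * (g u - e / 2) <= cap_mass sigma t e0 * (e / 2).
  apply: le_trans (H _) _ => [v Sv tv|].
    have h1 : L * enorm (u - v) <= e / 2.
      apply: le_trans (ler_wpM2l L0 (ts _ _ Su Sv tv)) _.
      rewrite mulrCA ger_pMr ?divr_gt0// ler_pdivrMr ?ltr_wpDl// mul1r.
      by rewrite lerDl.
    have := gL u v; rewrite ler_norml => /andP[_]; lra.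
  by rewrite mulrC -ler_pdivlMr ?subr_gt0.
by move: H; rewrite ler_pM2l//; lra.
Qed.

Variable V : \bar R.

Definition big_bounded Y := [/\ Y !=set0, bounded_set Y & (V <= mu Y)%E].

Definition half_width Y := mean (h Y).

Lemma big_bounded_translate Y a : big_bounded Y -> big_bounded ((fun y => y + a) @` Y).
Proof.
move=> [[y Yy] Yb VY]; split; first by exists (y + a), y.
  have [r _ Yr] := bounded_set_enorm Yb; apply: (@enorm_bounded_set _ _ _ (r + enorm a)).
  by move=> _ [z Yz <-]; apply: le_trans (enormD_le _ _) _; rewrite lerD2r Yr.
apply: le_trans VY _.
have := @lebesgue_outer_translate R d ((fun y => y + a) @` Y) (- a).
rewrite image_comp (_ : _ @` Y = Y)//.
apply/seteqP; split=> [_ [z Yz <-] /=|z Yz]; first by rewrite addrK.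
by exists z => //=; rewrite addrK.
Qed.

(** The function is odd and the mean is invariant under -1. Hence translations do not change the
    mean width. *)
Lemma sphere_mean_dotv a : mean (dotv a) = 0.
Proof.
have L : elipschitz (enorm a) (dotv a).
  by move=> u v; rewrite -dotvBr; exact: cauchy_schwarz.
have := sphere_mean_orthogonal sigma_sphere d_even (@opp_orthogonal R d) L.
rewrite (@eq_sphere_mean _ _ _ _ (fun u => (-1) * dotv a u)); last first.
  by move=> u _; rewrite mulmxN mulmx1 dotvNr mulN1r.
by rewrite sphere_meanZ; [lra|exact: elipschitz_continuous L].
Qed.

Lemma half_width_translate Y a : Y !=set0 -> bounded_set Y ->
  half_width ((fun y => y + a) @` Y) = half_width Y.
Proof.
move=> Y0 /bounded_set_enorm[r _ Yr]; rewrite /half_width.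
rewrite (@eq_sphere_mean _ _ _ _ (fun u => h Y u + dotv a u)); last first.
  by move=> u _; rewrite (support_translate Y0 Yr).
rewrite sphere_meanD ?sphere_mean_dotv ?addr0//.
  exact: support_continuous Y0 Yr.
have -> : dotv a = fun v => dotv v a by apply/funext => v; rewrite dotvC.
exact: dotv_continuous.
Qed.

Lemma det_orthogonal (Q : 'M[R]_d) : Q *m Q^T = 1%:M -> `|\det Q| = 1.
Proof.
move=> /(congr1 determinant); rewrite det_mulmx det_tr det1 -expr2 => /eqP.
by rewrite sqrf_eq1 => /orP[]/eqP ->; rewrite ?normrN1 ?normr1.
Qed.

Lemma big_bounded_mulmx Y (Q : 'M[R]_d) : Q *m Q^T = 1%:M -> big_bounded Y ->
  big_bounded ((fun y => y *m Q) @` Y).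
Proof.
move=> QQ [[y Yy] Yb VY]; split; first by exists (y *m Q), y.
  have [r _ Yr] := bounded_set_enorm Yb; apply: (@enorm_bounded_set _ _ _ r).
  by move=> _ [z Yz <-]; rewrite enorm_mulmx// Yr.
apply: le_trans VY _.
have QQ' := trmx_orthogonal QQ.
have dQ : \det Q^T != 0 by rewrite -normr_gt0 det_orthogonal.
have := det_bounded_unitmx d_gt0 dQ ((fun y => y *m Q) @` Y).
rewrite det_orthogonal// mul1e image_comp (_ : _ @` Y = Y)//.
apply/seteqP; split=> [_ [z Yz <-] /=|z Yz].
  by rewrite -mulmxA QQ mulmx1.
by exists z => //=; rewrite -mulmxA QQ mulmx1.
Qed.

Lemma half_width_mulmx Y (Q : 'M[R]_d) : Q *m Q^T = 1%:M -> Y !=set0 -> bounded_set Y ->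
  half_width ((fun y => y *m Q) @` Y) = half_width Y.
Proof.
move=> QQ Y0 /bounded_set_enorm[r _ Yr]; rewrite /half_width.
rewrite -[RHS](sphere_mean_orthogonal sigma_sphere d_even (trmx_orthogonal QQ)
  (support_elipschitz Y0 Yr)).
by apply: eq_sphere_mean => u _; rewrite support_mulmx.
Qed.

Lemma steinerE K x : steiner i0 K x -> exists a b, [/\ K a, K b,
  forall j, j != i0 -> a ord0 j = b ord0 j & x = 2^-1 *: (a + b *m reflection e0)].
Proof.
move=> [a [b [Ka Kb ab xi]]]; exists a, b; split => //.
  by move=> j /ab[-> ->].
apply: row_ext => j; rewrite mulmx_reflection dotv_delta !mxE eqxx /=.
case: eqP => [->|/eqP ji]; first by rewrite xi /= mulr1; lra.
by have [-> ->] := ab j ji; rewrite /= mulr0; lra.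
Qed.

Lemma steiner_big_bounded Y (r : R) : 0 <= r -> big_bounded Y ->
  (forall y, Y y -> enorm y <= r) ->
  big_bounded (steiner i0 (wulff Y)) /\
  forall x, steiner i0 (wulff Y) x -> enorm x <= r.
Proof.
move=> r0 [Y0 Yb VY] Yr.
have Sr x : steiner i0 (wulff Y) x -> enorm x <= r.
  move=> /steinerE[a [b [Ka Kb _ ->]]]; rewrite enormZ ger0_norm ?invr_ge0//.
  have h1 := wulff_enorm Y0 Yr r0 Ka; have h2 := wulff_enorm Y0 Yr r0 Kb.
  have := enormD_le a (b *m reflection e0).
  by rewrite enorm_mulmx ?reflection_orthogonal//; lra.
split => //; split.
- have [y Yy] := Y0; exists (upd y i0 0), y, y.
  have Ky := sub_wulff Y0 Yr Yy; split => //.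
    by move=> j /negbTE ji; rewrite mxE ji.
  by rewrite mxE eqxx subrr mul0r.
- exact: enorm_bounded_set Sr.
- apply: le_trans VY _; apply: le_trans (le_lebesgue_outer (sub_wulff Y0 Yr)) _.
  apply: lebesgue_outer_steiner; first exact: wulff_compact Y0 Yr r0.
  exact: wulff_vertically_convex.
Qed.

Variable m0 : R.
Hypothesis m0_ge0 : 0 <= m0.
Hypothesis m0_le : forall Y, big_bounded Y -> m0 <= half_width Y.

(* Steiner symmetrization does not decrease the volume, and
   h (steiner K) <= (h + h o R) / 2; near a minimum of the mean width this is
   almost an equality at every direction, which provides almost maximizers of
   v and of its mirror image on the same vertical line. *)
Lemma near_min_vertical_pairs (r e : R) : 0 < r -> 0 < e -> exists2 eta : R, 0 < eta &
  forall Y, big_bounded Y -> (forall y, Y y -> enorm y <= r) -> half_width Y <= m0 + eta ->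
  forall v, enorm v <= 1 -> exists a b, [/\ wulff Y a, wulff Y b,
    forall j, j != i0 -> a ord0 j = b ord0 j,
    h Y v - e <= dotv a v &
    h Y (v *m reflection e0) - e <= dotv b (v *m reflection e0)].
Proof.
move=> r0 ep; have e4 : 0 < e / 4 by rewrite divr_gt0.
have [|eta eta0 small] := @sphere_mean_small (2 * r) (e / 4) _ e4.
  by rewrite mulr_ge0// ltW.
exists eta => // Y Yb Yr mY; have [Y0 Ybd _] := Yb.
have [Sb Sr] := steiner_big_bounded (ltW r0) Yb Yr.
set Z := steiner i0 (wulff Y) in Sb Sr.
have [Z0 _ _] := Sb.
have RR := reflection_orthogonal e01.
have cY := support_continuous Y0 Yr; have cZ := support_continuous Z0 Sr.
have dotZ a b v : dotv (2^-1 *: (a + b *m reflection e0)) v =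
    (dotv a v + dotv b (v *m reflection e0)) / 2.
  by rewrite dotvZl dotvDl dotv_mulmx tr_reflection mulrC.
(* The deficit in the inequality between support functions. Its mean is the drop of the half width,
   at most [eta] by minimality of [m0], so the deficit is uniformly small. *)
pose g v := (h Y v + h Y (v *m reflection e0)) / 2 - h Z v.
have g0 v : 0 <= g v.
  rewrite subr_ge0; apply: (support_le Z0 Sr) => x /steinerE[a [b [Ka Kb _ ->]]].
  by rewrite dotZ; have := Ka v; have := Kb (v *m reflection e0); lra.
have gL : elipschitz (2 * r) g.
  move=> u v; have h1 := support_elipschitz Y0 Yr u v.
  have := support_elipschitz Y0 Yr (u *m reflection e0) (v *m reflection e0).
  rewrite -mulmxBl enorm_mulmx// => h2; have h3 := support_elipschitz Z0 Sr u v.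
  move: h1 h2 h3; rewrite /g !ler_norml => /andP[? ?] /andP[? ?] /andP[? ?].
  by apply/andP; split; lra.
have mg : mean g <= eta.
  have cYR := continuous_comp_orthogonal RR cY.
  have -> : mean g = half_width Y - half_width Z.
    rewrite /g sphere_meanB//; last first.
      by apply: continuous_mul; [exact: continuous_add|exact: continuous_cst].
    congr (_ - _).
    rewrite (@eq_sphere_mean _ _ _ _ (fun v => 2^-1 * (h Y v + h Y (v *m reflection e0)))); last first.
      by move=> v _; rewrite mulrC.
    rewrite sphere_meanZ ?sphere_meanD//; last exact: continuous_add.
    rewrite (sphere_mean_orthogonal sigma_sphere d_even RR (support_elipschitz Y0 Yr)).
    by rewrite /half_width; lra.
  by have := m0_le Sb; lra.
move=> v v1.
have [v0|vn0] := eqVneq v 0.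
  have [y Yy] := Y0; exists y, y; have Ky := sub_wulff Y0 Yr Yy; split => //;
  rewrite v0 ?mul0mx -(scale0r 0) (supportZ Y0 Yr)// scale0r mul0r dotvC dot0v; lra.
have [u [u1 vE]] : exists u, enorm u = 1 /\ v = enorm v *: u.
  exists ((enorm v)^-1 *: v); rewrite enorm_normalize//; split => //.
  by rewrite scalerA mulfV ?scale1r// enorm_eq0.
(* With [e / 4] lost here and [e / 4] in the deficit, the defects of [a] and [b] are nonnegative
   with sum at most [e], so each is at most [e]. *)
have [x Zx hx] := support_adherent Z0 Sr u e4.
have [a [b [Ka Kb ab xE]]] := steinerE Zx.
exists a, b; have gu := small g gL (fun v _ => g0 v) mg u u1.
have := Ka u; have := Kb (u *m reflection e0).
rewrite xE dotZ in hx; rewrite /g in gu => h1 h2.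
have h3 : h Y u - e <= dotv a u by lra.
have h4 : h Y (u *m reflection e0) - e <= dotv b (u *m reflection e0) by lra.
have n0 := enorm_ge0 v.
split => //; rewrite vE -?scalemxAl (supportZ Y0 Yr)// dotvZr.
  by have := ler_wpM2l n0 h3; have := ler_piMl (ltW ep) v1; rewrite mulrBr; lra.
by have := ler_wpM2l n0 h4; have := ler_piMl (ltW ep) v1; rewrite mulrBr; lra.
Qed.

Let asym Y v := h Y v - h Y (v *m reflection e0).

(* Almost maximizers are almost gradients of h Y, and those of v and of its mirror
   image differ by a multiple of e0; summing over N points from v to w, the
   increments of asym telescope to O(1/N). *)
Lemma near_min_asym_le (r e : R) : 0 < r -> 0 < e -> exists2 eta : R, 0 < eta &
  forall Y, big_bounded Y -> (forall y, Y y -> enorm y <= r) -> half_width Y <= m0 + eta ->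
  forall v w, enorm v <= 1 -> enorm w <= 1 -> v ord0 i0 = w ord0 i0 ->
  asym Y w - asym Y v <= e.
Proof.
move=> r0 ep.
(* The budget [e] is split: the telescoped products are at most [4 * r / N%:R], hence at most
   [e / 2], and the [N] errors [2 * e1] add up to [e / 2]. *)
have [N N0 Nr] : exists2 N : nat, 0 < N%:R :> R & 8 * r / e <= N%:R.
  exists (Num.bound (8 * r / e)).+1; first by rewrite ltr0n.
  rewrite ltW// (lt_le_trans (archi_boundP _))// ?divr_ge0 ?mulr_ge0 ?(ltW r0) ?(ltW ep)//.
  by rewrite ler_nat leqnSn.
have Nn0 : N%:R != 0 :> R by rewrite gt_eqF.
pose e1 := e / (4 * N%:R).
have e10 : 0 < e1 by rewrite divr_gt0// mulr_gt0.
have [eta eta0 H] := near_min_vertical_pairs r0 e10.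
exists eta => // Y Yb Yr mY v w v1 w1 vw; have [Y0 _ _] := Yb.
have /choice[ab Hab] : forall v, exists p : 'rV[R]_d * 'rV[R]_d, enorm v <= 1 ->
  [/\ wulff Y p.1, wulff Y p.2, forall j, j != i0 -> p.1 ord0 j = p.2 ord0 j,
    h Y v - e1 <= dotv p.1 v &
    h Y (v *m reflection e0) - e1 <= dotv p.2 (v *m reflection e0)].
  move=> z; have [z1|z1] := pselect (enorm z <= 1); last by exists (0, 0) => /z1.
  by have [a [b Hz]] := H Y Yb Yr mY z z1; exists (a, b).
(* Testing [(ab z).1] at [y] bounds [h Y z - h Y y] from above, and testing [(ab y).2] at the mirror
   image of [z] bounds the reflected increment from below. As [z - y] is horizontal, the reflection
   fixes it and [(ab y).2] may be exchanged for [(ab y).1]. *)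
have step y z : enorm y <= 1 -> enorm z <= 1 -> y ord0 i0 = z ord0 i0 ->
    asym Y z - asym Y y <= dotv ((ab z).1 - (ab y).1) (z - y) + 2 * e1.
  move=> y1 z1 yz.
  have [Kz _ _ hz _] := Hab z z1; have [_ Ky aby _ hy] := Hab y y1.
  have zyR : (z - y) *m reflection e0 = z - y.
    by rewrite mulmx_reflection dotv_delta !mxE yz subrr mulr0 scale0r subr0.
  have E : dotv (ab y).2 (z *m reflection e0) - dotv (ab y).2 (y *m reflection e0) =
      dotv (ab y).1 (z - y).
    rewrite -dotvBr -mulmxBl zyR /dotv; apply: eq_bigr => j _.
    have [->|/aby ->//] := eqVneq j i0.
    by rewrite !mxE yz subrr !mulr0.
  rewrite /asym; move: E; rewrite !dotvBl !dotvBr.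
  have := Kz y; have := Ky (z *m reflection e0); lra.
pose z k := v + (k%:R / N%:R) *: (w - v).
have zk k : (k <= N)%N -> enorm (z k) <= 1.
  move=> kN; have k0 : 0 <= k%:R / N%:R :> R by rewrite divr_ge0.
  have k1 : k%:R / N%:R <= 1 :> R by rewrite ler_pdivrMr// mul1r ler_nat.
  have -> : z k = (1 - k%:R / N%:R) *: v + (k%:R / N%:R) *: w.
    by rewrite /z scalerBr scalerBl scale1r addrA addrAC.
  apply: le_trans (enormD_le _ _) _; rewrite !enormZ !ger0_norm ?subr_ge0//.
  by nra.
have zi k : z k ord0 i0 = v ord0 i0 by rewrite !mxE vw subrr mulr0 addr0.
have z0 : z 0%N = v by rewrite /z mul0r scale0r addr0.
have zN : z N = w by rewrite /z divff ?gt_eqF// scale1r addrC subrK.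
have zS k : z k.+1 - z k = N%:R^-1 *: (w - v).
  rewrite /z opprD addrACA subrr add0r -scalerBl; congr (_ *: _).
  by rewrite -mulrBl -natr1 addrC addKr mul1r.
have tele : asym Y w - asym Y v <=
    \sum_(0 <= k < N) (dotv ((ab (z k.+1)).1 - (ab (z k)).1) (N%:R^-1 *: (w - v)) + 2 * e1).
  rewrite -[X in X - _](congr1 (asym Y) zN) -[X in _ - X](congr1 (asym Y) z0).
  rewrite -(telescope_sumr (fun k => asym Y (z k)))//.
  rewrite !big_mkord; apply: ler_sum => k _; rewrite -(zS k); apply: step.
  - by apply: zk; exact: ltnW.
  - exact: zk.
  - by rewrite !zi.
apply: le_trans tele _.
rewrite big_split /= sumr_const_nat subn0.
have -> : \sum_(0 <= k < N) dotv ((ab (z k.+1)).1 - (ab (z k)).1) (N%:R^-1 *: (w - v)) =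
    dotv ((ab w).1 - (ab v).1) (N%:R^-1 *: (w - v)).
  rewrite (eq_bigr (fun k => dotv (ab (z k.+1)).1 (N%:R^-1 *: (w - v)) -
     dotv (ab (z k)).1 (N%:R^-1 *: (w - v)))); last by move=> k _; rewrite dotvBl.
  by rewrite (telescope_sumr (fun k => dotv (ab (z k)).1 (N%:R^-1 *: (w - v))))// zN z0 dotvBl.
have -> : 2 * e1 *+ N = e / 2.
  by rewrite -mulr_natr /e1; field.
have h1 : dotv ((ab w).1 - (ab v).1) (N%:R^-1 *: (w - v)) <= (2 * r) * (N%:R^-1 * 2).
  apply: le_trans (dotv_le _ _) _; apply: ler_pM; rewrite ?enorm_ge0//.
    have [/(wulff_enorm Y0 Yr (ltW r0)) hw _ _ _ _] := Hab w w1.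
    have [/(wulff_enorm Y0 Yr (ltW r0)) hv _ _ _ _] := Hab v v1.
    by have := enormD_le (ab w).1 (- (ab v).1); rewrite enormN; lra.
  rewrite enormZ ger0_norm ?invr_ge0//; apply: ler_wpM2l; first by rewrite invr_ge0.
  by have := enormD_le w (- v); rewrite enormN; lra.
have h2 : 2 * r * (N%:R^-1 * 2) <= e / 2.
  rewrite (_ : 2 * r * (N%:R^-1 * 2) = (8 * r / 2) / N%:R); last by field.
  rewrite ler_pdivrMr//; move: Nr; rewrite ler_pdivrMr// mulrC; lra.
lra.
Qed.

(** Since [asym Y] depends almost only on the height, [v] is compared with its projection [w] on the
    vertical axis, where homogeneity of the support function makes [asym Y] linear. *)
Lemma near_min_reflection0 (r e : R) : 0 < r -> 0 < e -> exists2 eta : R, 0 < eta &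
  forall Y, big_bounded Y -> (forall y, Y y -> enorm y <= r) -> half_width Y <= m0 + eta ->
  forall v, enorm v <= 1 -> `|asym Y v - v ord0 i0 * (h Y e0 - h Y (- e0))| <= e.
Proof.
move=> r0 ep; have [eta eta0 H] := near_min_asym_le r0 ep.
exists eta => // Y Yb Yr mY v v1; have [Y0 _ _] := Yb.
have e0R : e0 *m reflection e0 = - e0.
  by rewrite mulmx_reflection e01 mulr1 scaler_nat mulr2n opprD addrA subrr sub0r.
pose w := v ord0 i0 *: e0.
have w1 : enorm w <= 1.
  rewrite enormZ /enorm e01 sqrtr1 mulr1; exact: le_trans (coord_le_enorm _ _) v1.
have wi : w ord0 i0 = v ord0 i0 by rewrite !mxE !eqxx mulr1.
have <- : asym Y w = v ord0 i0 * (h Y e0 - h Y (- e0)).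
  rewrite /asym /w; have [c0|c0] := leP 0 (v ord0 i0).
    by rewrite -scalemxAl e0R !(supportZ Y0 Yr)//; ring.
  have -> : v ord0 i0 *: e0 = (- v ord0 i0) *: (- e0) by rewrite scaleNr scalerN opprK.
  rewrite -scalemxAl mulNmx e0R opprK !(supportZ Y0 Yr) ?oppr_ge0 ?(ltW c0)//; ring.
have h1 := H Y Yb Yr mY v w v1 w1 (esym wi).
have h2 := H Y Yb Yr mY w v w1 v1 wi.
by rewrite ler_norml; lra.
Qed.

(** An orthogonal matrix carries [n] to [e0], and neither the volume bound nor the mean width is
    affected by it. *)
Lemma near_min_reflection (r e : R) : 0 < r -> 0 < e -> exists2 eta : R, 0 < eta &
  forall Y, big_bounded Y -> (forall y, Y y -> enorm y <= r) -> half_width Y <= m0 + eta ->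
  forall n v, dotv n n = 1 -> enorm v <= 1 ->
  `|h Y v - h Y (v *m reflection n) - dotv v n * (h Y n - h Y (- n))| <= e.
Proof.
move=> r0 ep; have [eta eta0 H] := near_min_reflection0 r0 ep.
exists eta => // Y Yb Yr mY n v n1 v1; have [Y0 Ybd _] := Yb.
have [Q [QQ nQ]] : exists Q : 'M[R]_d, Q *m Q^T = 1%:M /\ n *m Q = e0.
  have [->|ne0] := eqVneq n e0; first by exists 1%:M; rewrite trmx1 !mulmx1.
  have [q [q1 nq]] := exists_reflection n1 e01 ne0.
  by exists (reflection q); rewrite reflection_orthogonal.
have e0Q : e0 *m Q^T = n by rewrite -nQ -mulmxA QQ mulmx1.
have YQb := big_bounded_mulmx QQ Yb.
have YQr z : ((fun y => y *m Q) @` Y) z -> enorm z <= r.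
  by move=> [y /Yr yr <-]; rewrite enorm_mulmx.
have mYQ : half_width ((fun y => y *m Q) @` Y) <= m0 + eta.
  by rewrite half_width_mulmx.
have vQ1 : enorm (v *m Q) <= 1 by rewrite enorm_mulmx.
have := H _ YQb YQr mYQ (v *m Q) vQ1.
rewrite /asym !support_mulmx -[v *m Q *m Q^T]mulmxA QQ mulmx1 mulNmx e0Q.
have -> : (v *m Q) ord0 i0 = dotv v n by rewrite -dotv_delta dotv_mulmx e0Q.
have -> // : v *m Q *m reflection e0 *m Q^T = v *m reflection n.
rewrite !mulmx_reflection mulmxBl -scalemxAl e0Q -mulmxA QQ mulmx1.
by rewrite dotv_mulmx e0Q.
Qed.

Lemma near_min_near_ball (e : R) : 0 < e -> exists2 eta : R, 0 < eta &
  forall Y, big_bounded Y -> half_width Y <= m0 + eta ->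
  exists a, forall y, Y y -> enorm (y + a) <= m0 + e.
Proof.
move=> ep.
have Se0 : S e0 by apply/esphereP.
have c0 := cap_mass_gt0 sigma_sphere d_even ltr01 Se0.
set c := cap_mass sigma 0 e0 in c0.
(* A priori radius: if [Y] contains 0 and [y], its support function is at least the positive part of
   [dotv y u], which is [enorm y] times a cap function with [t = 0]; integration bounds
   [enorm y * c] by [m0 + 1]. *)
pose r := (m0 + 1) / c.
have r0 : 0 < r by rewrite divr_gt0// ltr_wpDl.
(* The [d] axis reflections and one further reflection cost [d.+1] errors [e1], together [e / 2];
   the other half of [e] pays for the excess of the half width over [m0]. *)
pose e1 := e / (2 * d.+1%:R).
have e10 : 0 < e1 by rewrite divr_gt0// mulr_gt0.
have [eta eta0 H] := near_min_reflection r0 e10.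
exists (Num.min eta (Num.min 1 (e / 2))); first by rewrite !lt_min eta0 ltr01 divr_gt0.
move=> Y' Yb' mY'; have [[y0 Yy0] Ybd' _] := Yb'.
pose Y := (fun y => y - y0) @` Y'.
have Yb : big_bounded Y by exact: big_bounded_translate.
have [Y0 Ybd _] := Yb.
have mYE : half_width Y = half_width Y' by apply: half_width_translate => //; exists y0.
have [q _ Yq] := bounded_set_enorm Ybd.
have [mY1 mY2 mY3] : [/\ half_width Y <= m0 + eta, half_width Y <= m0 + 1 &
    half_width Y <= m0 + e / 2].
  rewrite mYE; split; apply: le_trans mY' _; rewrite lerD2l !ge_min lexx ?orbT//.
have Yz : Y 0 by exists y0 => //; rewrite subrr.
have Yr y : Y y -> enorm y <= r.
  move=> Yy; have [->|yn0] := eqVneq y 0; first by rewrite enorm0 ltW.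
  have Su : S ((enorm y)^-1 *: y) by exact: enorm_normalize.
  rewrite ler_pdivlMr//; apply: le_trans mY2.
  rewrite /c -(cap_mass_eq sigma_sphere d_even 0 Su Se0) -sphere_meanZ; last first.
    exact: cap_fun_continuous.
  apply: sphere_mean_le.
  - by apply: continuous_mul; [exact: continuous_cst|exact: cap_fun_continuous].
  - exact: support_continuous Y0 Yq.
  move=> u _; rewrite /cap_fun subr0 dotvZl.
  have y0' : 0 < enorm y by rewrite enorm_gt0.
  rewrite maxr_pMr ?(ltW y0')// mulr0 mulVKf ?gt_eqF// ge_max.
  rewrite (dotv_le_support Y0 Yq)//=.
  by have := dotv_le_support Y0 Yq u Yz; rewrite dot0v.
pose ei i : 'rV[R]_d := delta_mx ord0 i.
have ei1 i : dotv (ei i) (ei i) = 1 by rewrite dotv_delta mxE !eqxx.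
(* Chosen so that [h2] agrees at the two opposite unit vectors of each axis, which cancels the
   linear term for the axis reflections. *)
pose a := \row_i ((h Y (ei i) - h Y (- ei i)) / 2) : 'rV[R]_d.
pose h2 v := h Y v - dotv a v.
have Hn n v : dotv n n = 1 -> enorm v <= 1 ->
    `|h2 v - h2 (v *m reflection n) - dotv v n * (h2 n - h2 (- n))| <= e1.
  move=> n1 v1; have := H Y Yb Yr mY1 n v n1 v1; congr (`|_| <= _).
  rewrite /h2 mulmx_reflection dotvBr dotvZr dotvNr; ring.
have Hi i v : enorm v <= 1 -> `|h2 v - h2 (v *m reflection (ei i))| <= e1.
  move=> v1; have := Hn (ei i) v (ei1 i) v1.
  have -> : h2 (ei i) - h2 (- ei i) = 0.
    by rewrite /h2 dotvNr dotv_delta mxE; field.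
  by rewrite mulr0 subr0.
(* One axis reflection at a time leads from [v] to its antipode in [d] steps. *)
pose flip k v : 'rV[R]_d := \row_i (if (i < k)%N then - v ord0 i else v ord0 i).
have flipn k v : enorm (flip k v) = enorm v.
  rewrite /enorm /dotv; congr Num.sqrt; apply: eq_bigr => i _.
  by rewrite mxE; case: ifP => _; rewrite ?mulrNN.
have Hflip k v : (k <= d)%N -> enorm v <= 1 -> `|h2 v - h2 (flip k v)| <= k%:R * e1.
  elim: k => [|k IH] kd v1.
    have -> : flip 0%N v = v by apply/rowP => i; rewrite mxE.
    by rewrite subrr normr0 mul0r.
  have -> : flip k.+1 v = flip k v *m reflection (ei (Ordinal kd)).
    apply: row_ext => i; rewrite mulmx_reflection dotv_delta !mxE ltnn ltnS leq_eqVlt eqxx /=.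
    have [->|ik] := eqVneq i (Ordinal kd); first by rewrite /= eqxx ltnn /=; ring.
    have -> : (i == k :> nat) = false by apply: negbTE; apply: contra ik => /eqP ik; apply/eqP/val_inj.
    by rewrite mulr0 subr0.
  have := Hi (Ordinal kd) (flip k v); rewrite flipn => /(_ v1).
  have := IH (ltnW kd) v1; rewrite -natr1 mulrDl mul1r.
  by rewrite !ler_norml; lra.
have Hopp n : dotv n n = 1 -> `|h2 n - h2 (- n)| <= d%:R * e1.
  move=> n1; have <- : flip d n = - n by apply/rowP => i; rewrite !mxE ltn_ord.
  by apply: Hflip => //; rewrite /enorm n1 sqrtr1.
have Huw u w : S u -> S w -> h2 u <= h2 w + d.+1%:R * e1.
  move=> Su Sw; have u1 : dotv u u = 1 by apply/esphereP.
  have w1 : dotv w w = 1 by apply/esphereP.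
  have [->|uw] := eqVneq u w; first by rewrite lerDl mulr_ge0// ltW.
  have [n [n1 un]] := exists_reflection u1 w1 uw.
  have := Hn n u n1; rewrite un Su => /(_ (lexx _)).
  have h3 : `|dotv u n * (h2 n - h2 (- n))| <= d%:R * e1.
    rewrite normrM; apply: le_trans (Hopp n n1); apply: ler_piMl => //.
    by have := cauchy_schwarz u n; rewrite Su {1}/enorm n1 sqrtr1 mulr1.
  move: h3; rewrite -natr1 mulrDl mul1r !ler_norml; lra.
have cY := support_continuous Y0 Yq.
have ca : continuous (dotv a).
  have -> : dotv a = fun v => dotv v a by apply/funext => v; rewrite dotvC.
  exact: dotv_continuous.
have mh2 : mean h2 = half_width Y by rewrite sphere_meanB// sphere_mean_dotv subr0.
have ch2 : continuous h2 by exact: continuous_sub.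
have ed : d.+1%:R * e1 = e / 2 by rewrite /e1; field; rewrite nat1r pnatr_eq0.
have h2le u : S u -> h2 u <= m0 + e.
  move=> Su; have : mean (fun=> h2 u - e / 2) <= mean h2.
    apply: sphere_mean_le => //; first exact: continuous_cst.
    by move=> w Sw; have := Huw u w Su Sw; rewrite ed; lra.
  by rewrite (sphere_mean_cst sigma_sphere) mh2; lra.
(* [h2] is the support function of [Y] translated by [- a]; in the direction of [z] it is at least
   [enorm z]. *)
exists (- y0 - a) => y Yy; rewrite addrA; set z := y - y0 - a.
have [->|z0] := eqVneq z 0; first by rewrite enorm0 addr_ge0// ltW.
have Su : S ((enorm z)^-1 *: z) by exact: enorm_normalize.
apply: le_trans (h2le _ Su).
have Yy1 : Y (y - y0) by exists y.
have : dotv z ((enorm z)^-1 *: z) <= h2 ((enorm z)^-1 *: z).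
  by rewrite {1}/z dotvBl /h2 lerD2r; exact: (dotv_le_support Y0 Yq).
by rewrite dotvZr -sqr_enorm expr2 mulKf// enorm_eq0.
Qed.

End Stability.

(** * Symplectomorphisms *)

Lemma le_sqr_eps (R : realType) (x m : R) : 0 <= m ->
  (forall e, 0 < e -> x <= (m + e) ^+ 2) -> x <= m ^+ 2.
Proof.
move=> m0 H; rewrite leNgt; apply/negP => mx.
have x0 : 0 <= x by apply: le_trans (ltW mx); rewrite exprn_ge0.
have ms : m < Num.sqrt x by rewrite -(ger0_norm m0) -sqrtr_sqr ltr_sqrt// (le_lt_trans _ mx)// sqr_ge0.
have := H ((Num.sqrt x - m) / 2); rewrite divr_gt0 ?subr_gt0// => /(_ isT).
rewrite -[leLHS]sqr_sqrtr// ler_pXn2r ?nnegrE ?sqrtr_ge0//; last by lra.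
by apply/negP; rewrite -ltNge; lra.
Qed.

Section Smooth.
Variables (R : realType) (n : nat).
Local Notation E := 'rV[R]_(n + n).
Implicit Types (f g : E -> E) (a : E).

Lemma derive_addr_cst f a (v : E) : 'D_v (fun x => f x + a) = 'D_v f.
Proof.
apply/funext => x; rewrite /derive.
have -> : (fun t : R => t^-1 *: (((fun y => f y + a) \o shift x) (t *: v) - (f x + a))) =
    (fun t : R => t^-1 *: ((f \o shift x) (t *: v) - f x)); last by [].
by apply/funext => t /=; rewrite opprD addrACA subrr addr0.
Qed.

Lemma derive_shift f a (v : E) : 'D_v (fun x => f (x + a)) = (fun x => 'D_v f (x + a)).
Proof.
apply/funext => x; rewrite /derive.
have -> : (fun t : R => t^-1 *: (((fun y => f (y + a)) \o shift x) (t *: v) - f (x + a))) =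
    (fun t : R => t^-1 *: ((f \o shift (x + a)) (t *: v) - f (x + a))); last by [].
by apply/funext => t /=; rewrite addrA.
Qed.

Lemma differentiable_addr_cst f a (x : E) : differentiable f x ->
  differentiable (fun y => f y + a) x.
Proof.
move=> df; have -> : (fun y => f y + a) = f + cst a by [].
by apply: differentiableD => //; exact: differentiable_cst.
Qed.

Lemma shift_differentiable a (x : E) : differentiable (fun y => y + a) x.
Proof. exact: (@differentiable_addr_cst id a x (is_diff_id x).(ex_diff)). Qed.

Lemma Ck_on_addr_cst k (U : set E) f a : Ck_on k U f -> Ck_on k U (fun x => f x + a).
Proof.
case: k => [|k] /=.
  move=> cf x Ux; exact: (@continuousD _ E E f (cst a) x (cf x Ux) (@cst_continuous E E a x)).
move=> [df Df]; split=> [x Ux|v]; last by rewrite derive_addr_cst.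
exact: differentiable_addr_cst (df x Ux).
Qed.

Lemma Ck_on_shift k f a : Ck_on k setT f -> Ck_on k setT (fun x => f (x + a)).
Proof.
elim: k f => [|k IH] f /=.
  move=> cf x _; apply: (@continuous_comp E E E (fun x => x + a) f); last exact: (cf _ I).
  exact: differentiable_continuous (shift_differentiable a x).
move=> [df Df]; split=> [x _|v]; last by rewrite derive_shift; exact: (IH _ (Df v)).
apply: (@differentiable_comp _ E E E (fun x => x + a) f); last exact: (df _ I).
exact: shift_differentiable.
Qed.

Lemma Ck_on_cst k (U : set E) a : Ck_on k U (fun _ : E => a).
Proof.
elim: k a => [|k IH] a /=; first by move=> x _; exact: cst_continuous.
split=> [x _|v]; first exact: differentiable_cst.
have -> : 'D_v (fun _ : E => a) = (fun _ : E => 0); last exact: IH.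
by apply/funext => x; rewrite derive_cst.
Qed.

Lemma Ck_on_id k (U : set E) : Ck_on k U (fun x : E => x).
Proof.
case: k => [|k] /=; first by move=> x _; exact: cvg_id.
split=> [x _|v]; first by have [] := is_diff_id x.
have -> : 'D_v (fun x : E => x) = (fun _ : E => v); last exact: Ck_on_cst.
by apply/funext => x; rewrite derive_id.
Qed.

End Smooth.

Section Symplectomorphism.
Variables (R : realType) (n : nat).
Hypothesis n_gt0 : (0 < n)%N.
Local Notation E := 'rV[R]_(n + n).
Local Notation mu := (@lebesgue_outer R (n + n)).
Implicit Types (X Y : set E) (phi f : E -> E).

Let d_gt0 : (0 < n + n)%N.
Proof. by rewrite addn_gt0 n_gt0. Qed.

Lemma symp_mx_sqr : symp_mx R n *m symp_mx R n = - 1%:M.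
Proof.
rewrite /symp_mx mulmx_block !mul0mx !mulmx0 !mul1mx !mulmx1 !add0r !addr0.
by rewrite [in RHS]scalar_mx_block opp_block_mx !oppr0.
Qed.

(** Conjugating the matrix of the form by [J] and its transpose gives it back. It is invertible, its
    square being -1, so the determinant of [J] has square 1. *)
Lemma det_preserves_omega (J : 'M[R]_(n + n)) :
  (forall u v, omega (u *m J) (v *m J) = omega u v) -> `|\det J| = 1.
Proof.
move=> H.
have JJ : J *m symp_mx R n *m J^T = symp_mx R n.
  have entry (A : 'M[R]_(n + n)) i j :
      A i j = (delta_mx (0 : 'I_1) i *m A *m (delta_mx (0 : 'I_1) j)^T) ord0 ord0.
    by rewrite -rowE trmx_delta -colE !mxE.
  apply/matrixP => i j; have := H (delta_mx 0 i) (delta_mx 0 j).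
  by rewrite /omega trmx_mul !entry !mulmxA.
have O0 : \det (symp_mx R n) != 0.
  have := congr1 determinant symp_mx_sqr; rewrite det_mulmx -scaleN1r detZ det1 mulr1.
  move=> O2; apply: contra_eq_neq O2 => ->.
  by rewrite mul0r eq_sym signr_eq0.
have := congr1 determinant JJ; rewrite !det_mulmx det_tr mulrAC -expr2 => /eqP.
rewrite -subr_eq0 -{2}[\det (symp_mx R n)]mul1r -mulrBl mulf_eq0 (negbTE O0) orbF.
by rewrite subr_eq0 sqrf_eq1 => /orP[]/eqP ->; rewrite ?normrN1 ?normr1.
Qed.

Lemma Symp_continuous phi : @Symp R n phi -> continuous phi.
Proof.
move=> [[_ _ sphi _ _] _] x; have [/(_ x I) + _] := sphi 1%N.
exact: differentiable_continuous.
Qed.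

Lemma Symp_bounded phi X : @Symp R n phi -> bounded_set X -> bounded_set (phi @` X).
Proof.
move=> /Symp_continuous cphi /bounded_set_enorm[r _ Xr].
have Bc : compact (eball (n + n) r : set E).
  apply: bounded_closed_compact; first by apply: (@enorm_bounded_set _ _ _ r).
  have -> : eball (n + n) r = @enorm R (n + n) @^-1` [set t | t <= r] by [].
  by apply: closed_comp => [u _|]; [exact: enorm_continuous|exact: closed_le].
have : compact (phi @` eball (n + n) r).
  by apply: continuous_compact => //; exact: continuous_subspaceT.
move=> /compact_bounded[M [Mr HM]]; exists M; split => // C MC _ [x Xx <-].
by apply: HM MC _ _; exists x => //; exact: Xr.
Qed.

(** The estimate for differentiable images is applied to the inverse [g], whose Jacobian at [phi x]
    is by the chain rule inverse to that of [phi]. This makes the image of [X] a competitor for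
    [m0]. *)
Lemma Symp_volume phi X : @Symp R n phi -> (mu X <= mu (phi @` X))%E.
Proof.
move=> [[_ _ sphi ophi [g [sg gK]]] phiT].
have dphi x : differentiable phi x by have [H _] := sphi 1%N; exact: H.
have dg x : differentiable g x by have [H _] := sg 1%N; apply: H; rewrite phiT.
have gX : g @` (phi @` X) = X.
  rewrite image_comp; apply/seteqP; split=> [_ [x Xx <-] /=|x Xx]; first by rewrite gK.
  by exists x => //=; rewrite gK.
rewrite -{1}gX.
apply: lebesgue_outer_differentiable_image => // y.
have [x _ <-] : (phi @` setT) y by rewrite phiT.
have Jphi : `|\det (jacobian phi x)| = 1.
  apply: det_preserves_omega => u v; rewrite -(ophi x I u v).
  by rewrite /jacobian !mul_rV_lin1.
have DC := diff_comp (dphi x) (dg (phi x)).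
have gid : g \o phi = id by apply/funext => z; exact: gK.
have aux (f : E -> E) : f = id -> ('d f x : E -> E) = id.
  by move=> ->; exact: diff_val.
have {}DC := etrans (esym DC) (aux _ gid).
have JJ : jacobian phi x *m jacobian g (phi x) = 1%:M.
  apply/row_matrixP => i; rewrite !rowE mulmx1 mulmxA /jacobian !mul_rV_lin1.
  exact: (congr1 (fun F : E -> E => F (delta_mx 0 i)) DC).
have norm1 (a b : R) : a * b = 1 -> `|a| = 1 -> `|b| = 1.
  by move=> ab a1; rewrite -[LHS]mul1r -a1 -normrM ab normr1.
apply: (norm1 _ _ _ Jphi); rewrite -det_mulmx JJ; exact: det1.
Qed.

Lemma Symp_id : @Symp R n id.
Proof.
split; last by rewrite image_id.
split; rewrite ?image_id; try exact: openT.
- by move=> k; exact: Ck_on_id.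
- by move=> x _ u v; rewrite diff_val.
- by exists id; split => // k; exact: Ck_on_id.
Qed.

(** A near-minimizing image lies in a ball of uncontrolled centre; the translation moves that centre
    to 0. *)
Lemma Symp_translate phi (a : E) : @Symp R n phi ->
  open_symplectic_embedding setT (fun x => phi x + a).
Proof.
move=> [[_ _ sphi ophi [g [sg gK]]] phiT].
have imT : (fun x => phi x + a) @` setT = setT.
  apply/seteqP; split => // y _; have [x _ xy] : (phi @` setT) (y - a) by rewrite phiT.
  by exists x => //; rewrite xy subrK.
rewrite phiT in sg.
split; rewrite ?imT; try exact: openT.
- by move=> k; apply: Ck_on_addr_cst.
- move=> x _ u v; rewrite -(ophi x I u v).
  have dphi : differentiable phi x by have [H _] := sphi 1%N; exact: H.
  have dd w : 'd (fun x => phi x + a) x w = 'd phi x w.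
    have D1 := deriveE w (differentiable_addr_cst a dphi).
    have D2 := deriveE w dphi.
    exact: (etrans (esym D1) (etrans (congr1 (fun G : E -> E => G x) (derive_addr_cst phi a w)) D2)).
  exact: (congr2 (@omega R n) (dd u) (dd v)).
- exists (fun y => g (y - a)); split=> [k|x _]; last by rewrite addrK gK.
  exact: Ck_on_shift.
Qed.

Lemma embedding_capacity_le X (f : E -> E) (r : R) : 0 <= r ->
  open_symplectic_embedding setT f -> f @` X `<=` eball (n + n) r ->
  embedding_capacity X <= r ^+ 2.
Proof.
move=> r0 sf fX; apply: ge_inf; last first.
  by exists r => //; split => //; exists f; split => //; exists setT.
by exists 0 => _ [t _ <-]; exact: sqr_ge0.
Qed.

Lemma lebesgue_outer_eball_le (r : R) : 0 < r ->
  (mu (eball (n + n) r) <= (r ^+ (n + n))%:E * mu (eball (n + n) 1))%E.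
Proof.
move=> r0; have dr : \det (r%:M : 'M[R]_(n + n)) != 0.
  by rewrite det_scalar expf_neq0// gt_eqF.
have := det_bounded_unitmx d_gt0 dr (eball (n + n) 1).
rewrite det_scalar ger0_norm ?exprn_ge0 ?(ltW r0)//; apply: le_trans.
apply: le_lebesgue_outer => x xr; exists (r^-1 *: x).
  by rewrite /eball /= enormZ ger0_norm ?invr_ge0 ?(ltW r0)// ler_pdivrMl// mulr1.
by rewrite mul_mx_scalar scalerA divff ?scale1r// gt_eqF.
Qed.

Lemma lebesgue_outer_bounded X : bounded_set X -> mu X \is a fin_num.
Proof.
move=> /bounded_set_enorm[r r0 Xr]; rewrite ge0_fin_numE ?lebesgue_outer_ge0//.
have rr i : (const_mx (- r) : E) ord0 i <= (const_mx r : E) ord0 i by rewrite !mxE; lra.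
apply: (@le_lt_trans _ _ (mu (box (const_mx (- r)) (const_mx r)))).
  apply: le_lebesgue_outer => x /Xr xr i; rewrite !mxE -ler_norml.
  exact: le_trans (coord_le_enorm _ _) xr.
by apply: le_lt_trans (lebesgue_outer_box d_gt0 rr) _; rewrite ltey.
Qed.

Lemma normalized_volume_le X Y (a : E) (r : R) : bounded_set X -> (mu X <= mu Y)%E ->
  0 < r -> (forall y, Y y -> enorm (y + a) <= r) -> normalized_volume X <= r ^+ 2.
Proof.
move=> Xb XY r0 Yr.
have Bf : mu (eball (n + n) 1) \is a fin_num.
  by apply: lebesgue_outer_bounded; apply: (@enorm_bounded_set _ _ _ 1).
have Xf := lebesgue_outer_bounded Xb.
have XB : fine (mu X) <= r ^+ (n + n) * fine (mu (eball (n + n) 1)).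
  rewrite -lee_fin EFinM !fineK//; apply: le_trans (lebesgue_outer_eball_le r0).
  apply: le_trans XY _; apply: (le_trans _ (lebesgue_outer_translate _ (- a))).
  by apply: le_lebesgue_outer => y /Yr yr; exists (y + a) => //; rewrite addrK.
have B0 : 0 <= fine (mu (eball (n + n) 1)) by rewrite fine_ge0// lebesgue_outer_ge0.
have X0 : 0 <= fine (mu X) by rewrite fine_ge0// lebesgue_outer_ge0.
have rn0 : 0 <= r ^+ (n + n) by rewrite exprn_ge0// ltW.
have ratio : fine (mu X) / fine (mu (eball (n + n) 1)) <= r ^+ (n + n).
  (* Division by a zero volume would yield 0, which satisfies the bound. *)
  move: B0; rewrite le_eqVlt => /predU1P[<-|B0]; first by rewrite invr0 mulr0.
  by rewrite ler_pdivrMr.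
rewrite /normalized_volume.
have -> : r ^+ 2 = (r ^+ (n + n)) `^ n%:R^-1.
  rewrite addnn -mul2n exprM -[X in X `^ _]powR_mulrn ?sqr_ge0// -powRrM.
  by rewrite mulfV ?pnatr_eq0 -?lt0n// powRr1// sqr_ge0.
apply: ge0_ler_powR => //; rewrite ?nnegrE ?invr_ge0 ?divr_ge0//.
Qed.

End Symplectomorphism.

Lemma mean_width_half_width (R : realType) (d : nat)
    (sigma : probability (borel_space R d) R) (Y : set 'rV[R]_d) :
  rotation_invariant_sphere_probability sigma -> ~~ odd d ->
  Y !=set0 -> bounded_set Y -> mean_width sigma Y = 2 * half_width sigma Y.
Proof.
move=> sigma_sphere d_even Y0 /bounded_set_enorm[r _ Yr].
have hL := support_elipschitz Y0 Yr; have hc := support_continuous Y0 Yr.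
have oo := @opp_orthogonal R d.
rewrite /mean_width -/(sphere_mean sigma _).
rewrite (@eq_sphere_mean _ _ _ _ (fun u => support_function Y u +
  support_function Y (u *m - 1%:M))); last by move=> u _; rewrite mulmxN mulmx1.
rewrite sphere_meanD//; last exact: continuous_comp_orthogonal oo hc.
by rewrite (sphere_mean_orthogonal sigma_sphere d_even oo hL) /half_width; ring.
Qed.

Lemma half_width_ge0 (R : realType) (d : nat)
    (sigma : probability (borel_space R d) R) (Y : set 'rV[R]_d) :
  rotation_invariant_sphere_probability sigma -> ~~ odd d ->
  Y !=set0 -> bounded_set Y -> 0 <= half_width sigma Y.
Proof.
move=> sigma_sphere d_even Y0 Yb; have [r _ Yr] := bounded_set_enorm Yb.
rewrite -(pmulr_rge0 _ (ltr0Sn R 1)) -mean_width_half_width//.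
apply: Rintegral_ge0 => u _; have [y Yy] := Y0.
have := dotv_le_support Y0 Yr u Yy; have := dotv_le_support Y0 Yr (- (u : 'rV[R]_d)) Yy.
by rewrite dotvNr; lra.
Qed.

Theorem proposition1p22 (R : realType) (n : nat) (n_gt0 : (0 < n)%N)
    (sigma : probability (borel_space R (n + n)%N) R)
    (sigma_sphere : rotation_invariant_sphere_probability sigma)
    (X : set 'rV[R]_(n + n)) (X_bounded : bounded_set X)
    (X_measurable : lebesgue_measurable X) :
  normalized_volume X < embedding_capacity X ->
  normalized_volume X < symplectic_mean_width sigma X ^+ 2 / 4%:R.
Proof.
move=> vc.
have d_even : ~~ odd (n + n) by rewrite addnn odd_double.
have d_gt0 : (0 < n + n)%N by rewrite addn_gt0 n_gt0.
have v0 : 0 <= normalized_volume X by exact: powR_ge0.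
(* For empty [X] the identity and the ball of radius 0 give capacity at most 0, against the strict
   hypothesis. *)
have [/set0P X0|X0] := pselect (X != set0); last first.
  move: vc; rewrite ltNge => /negP[]; apply: le_trans v0.
  have -> : 0 = 0 ^+ 2 :> R by rewrite expr0n.
  apply: (@embedding_capacity_le _ _ _ id) => //.
    by have [] := Symp_id R n.
  by move=> y [x Xx _]; exfalso; apply: X0; apply/set0P; exists x.
pose V := lebesgue_outer X.
pose hw := half_width sigma.
pose W := [set hw Y | Y in [set Y | big_bounded V Y]].
have XV : big_bounded V X by [].
have W0 : W !=set0 by exists (hw X), X.
have hw0 Y : big_bounded V Y -> 0 <= hw Y by move=> [? ? _]; exact: half_width_ge0.
have Wlb : has_lbound W by exists 0 => _ [Y /hw0 ? <-].
pose m0 := inf W.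
have m0_ge0 : 0 <= m0 by apply: lb_le_inf => // _ [Y /hw0 ? <-].
have m0_le Y : big_bounded V Y -> m0 <= hw Y by move=> YV; apply: ge_inf => //; exists Y.
have near_ball := near_min_near_ball sigma_sphere d_even d_gt0 m0_ge0 m0_le.
have v_le : normalized_volume X <= m0 ^+ 2.
  apply: le_sqr_eps => // e e0; have [eta eta0 H] := near_ball e e0.
  have [_ [Y YV <-] /ltW hY] := inf_adherent eta0 (conj W0 Wlb).
  have [a Ya] := H Y YV hY; have [_ _ XY] := YV.
  by apply: (normalized_volume_le n_gt0 X_bounded XY _ Ya); rewrite ltr_wpDl.
have phiV phi : @Symp R n phi -> big_bounded V (phi @` X).
  move=> sphi; split; last exact: Symp_volume.
    by have [x Xx] := X0; exists (phi x), x.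
  exact: Symp_bounded.
pose M := [set mean_width sigma (phi @` X) | phi in @Symp R n].
have ME phi : @Symp R n phi -> mean_width sigma (phi @` X) = 2 * hw (phi @` X).
  by move=> /phiV[? ? _]; exact: mean_width_half_width.
have M0 : M !=set0 by exists (mean_width sigma (id @` X)), id => //; exact: Symp_id.
have Mge : lbound M (2 * m0).
  by move=> _ [phi sphi <-]; rewrite ME// ler_pM2l//; apply: m0_le; exact: phiV.
have Mlb : has_lbound M by exists (2 * m0).
have mM : 2 * m0 <= symplectic_mean_width sigma X by exact: lb_le_inf.
rewrite ltNge; apply/negP => Mv.
have Mm : symplectic_mean_width sigma X <= 2 * m0.
  rewrite -(@ler_pXn2r _ 2)// ?nnegrE ?mulr_ge0//; last first.
    by apply: le_trans mM; rewrite mulr_ge0.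
  by rewrite exprMn; move: (le_trans Mv v_le); rewrite expr2; lra.
have vE : m0 ^+ 2 <= normalized_volume X.
  apply: le_trans Mv; rewrite ler_pdivlMr//.
  have -> : m0 ^+ 2 * 4%:R = (2 * m0) ^+ 2 by ring.
  by rewrite ler_pXn2r// ?nnegrE ?mulr_ge0// (le_trans _ mM)// mulr_ge0.
move: vc; apply/negP; rewrite -leNgt; apply: le_trans vE.
apply: le_sqr_eps => // e e0; have [eta eta0 H] := near_ball e e0.
(* The tolerance is [2 * eta] because the mean width is twice the half width. *)
have [|_ [phi sphi <-] hphi] := @inf_adherent _ M (2 * eta) _ (conj M0 Mlb).
  by rewrite mulr_gt0.
have [|a Ha] := H (phi @` X) (phiV _ sphi).
  rewrite -(ler_pM2l (ltr0Sn R 1)) -ME// mulrDr; apply/ltW.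
  by apply: lt_le_trans hphi _; rewrite lerD2r.
apply: (embedding_capacity_le _ (Symp_translate a sphi)); first by rewrite addr_ge0// ltW.
by move=> _ [x Xx <-]; apply: Ha; exists x.
Qed.
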